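(* Let $\eta > 0$, $\nu < \eta$, $\rho \in [0,1]$, let $B^X$, $B^Y$ be two independent standard $(\mathcal{F}_t)_{t\ge 0}$-Brownian motions, and let $X = B^X$, $(\alpha_k)_{k\ge0}$, $(\tau_k)_{k\ge0}$, $(\tilde{B}^k)_{k\ge0}$, $(Y^k)_{k\ge 0}$, $N_t$ and $Y$ be as defined in the context. Then: (i) $(Y^k)_{k\ge0}$ is a sequence of $(\mathcal{F}_t)_{t\ge0}$-Brownian motions and $(\tau_k)_{k\ge0}$ is a sequence of $(\mathcal{F}_t)_{t\ge0}$-stopping times. (ii) For every $n \ge 0$ and $t > 0$, $$X_t - Y^n_t = \left(1+(-1)^k\rho\right)\left(B^X_t - B^X_{\tau_k}\right) - \sqrt{1-\rho^2}\left(B^Y_t - B^Y_{\tau_k}\right) + \alpha_k \quad \text{if } \tau_k \le t \le \tau_{k+1},\ 0 \le k \le n,$$ and $$X_t - Y^n_t = \left(1+(-1)^n\rho\right)\left(B^X_t - B^X_{\tau_{n+1}}\right) - \sqrt{1-\rho^2}\left(B^Y_t - B^Y_{\tau_{n+1}}\right) + \alpha_{n+1} \quad \text{if } \tau_{n+1} \le t.$$ (iii) $N_t < \infty$ almost surely, for every $t>0$. (iv) $Y$ is a Brownian motion.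
   Context: $B^X$ and $B^Y$ are independent standard Brownian motions (started at $0$) with respect to a filtration $(\mathcal{F}_t)_{t\ge0}$ on a filtered probability space $(\Omega,\mathcal{F},(\mathcal{F}_t)_{t\ge0},\mathbb{P})$ satisfying the usual conditions; $X$ denotes $B^X$. Set $\alpha_0 = 0$, $\alpha_k = \eta$ if $k$ is odd, and $\alpha_k = \nu$ if $k$ is even and $k \ne 0$. For a Brownian motion $B$ and a stopping time $\tau$, $\mathcal{R}(B,\tau)$ denotes the reflection of $B$ at time $\tau$: $\mathcal{R}(B,\tau)_t = B_t - 2(B_t - B_\tau)\mathbf{1}_{t \ge \tau}$ (that is, $B_t$ for $t<\tau$ and $2B_\tau - B_t$ for $t \ge \tau$). Define recursively $\tau_0 = 0$, $\tilde{B}^0 = -B^X$, $Y^0 = \rho\tilde{B}^0 + \sqrt{1-\rho^2}\,B^Y$, and for $k \ge 1$ $$\tau_k = \inf\{t \ge \tau_{k-1} : B^X_t - Y^{k-1}_t = \alpha_k\},\quad \tilde{B}^k = \mathcal{R}(\tilde{B}^{k-1},\tau_k),\quad Y^k = \rho\tilde{B}^k + \sqrt{1-\rho^2}\,B^Y,$$ with $\inf\emptyset = +\infty$. $N_t = \sum_{n=1}^\infty \mathbf{1}_{\tau_n \le t}$ is the number of reflections up to time $t$, and $Y_t = Y_t^{N_t}$ (defined almost surely, by (iii)). *)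

(* Defs.v *)
From HB Require Import structures.
From mathcomp Require Import all_boot all_order all_algebra.
From mathcomp Require Import all_classical all_reals all_analysis.

Set Implicit Arguments.
Unset Strict Implicit.
Unset Printing Implicit Defensive.

Import Order.TTheory GRing.Theory Num.Theory.
Import numFieldNormedType.Exports.

Local Open Scope classical_set_scope.
Local Open Scope ring_scope.

(* Time runs over [0, +oo[: a process or a filtration is a function of a real
   time, of which only the values at nonnegative times are ever used. *)

Definition filtration (R : realType) (d : measure_display)
    (T : measurableType d) (F : R -> set_system T) : Prop :=
  [/\ forall t, 0 <= t -> sigma_algebra setT (F t),
      forall t, 0 <= t -> F t `<=` measurable
    & forall s t, 0 <= s -> s <= t -> F s `<=` F t].

(* As F 0 is contained in the ambient sigma-algebra, the first condition also
   makes the probability space complete. *)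
Definition usual_conditions (R : realType) (d : measure_display)
    (T : measurableType d) (P : probability T R) (F : R -> set_system T)
    : Prop :=
  (forall A : set T, P.-negligible A -> F 0 A) /\
  (forall t, 0 <= t -> \bigcap_(s in [set s | t < s]) F s = F t).

Definition adapted (R : realType) (d : measure_display) (T : measurableType d)
    (F : R -> set_system T) (B : R -> T -> R) : Prop :=
  forall t, 0 <= t -> forall U : set R, measurable U -> F t (B t @^-1` U).

Definition stopping_time (R : realType) (d : measure_display)
    (T : measurableType d) (F : R -> set_system T) (tau : T -> \bar R)
    : Prop :=
  (forall w, (0 <= tau w)%E) /\
  (forall t, 0 <= t -> F t [set w | (tau w <= t%:E)%E]).

Definition independent_systems (R : realType) (d : measure_display)
    (T : measurableType d) (P : probability T R) (G H : set_system T) : Prop :=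
  forall A C, G A -> H C -> P (A `&` C) = (P A * P C)%E.

Definition sigma_rv (R : realType) (T : Type) (X : T -> R) : set_system T :=
  preimage_set_system setT X measurable.

Definition sigma_process (R : realType) (T : Type) (B : R -> T -> R)
    : set_system T :=
  <<s \bigcup_(t in `[0, +oo[) sigma_rv (B t) >>.

Definition independent_processes (R : realType) (d : measure_display)
    (T : measurableType d) (P : probability T R) (B W : R -> T -> R) : Prop :=
  independent_systems P (sigma_process B) (sigma_process W).

Definition continuous_path_from0 (R : realType) (T : Type) (B : R -> T -> R)
    (w : T) : Prop :=
  B 0 w = 0 /\ {within `[0, +oo[, continuous (B ^~ w)}.

(* Standard (F_t)-Brownian motion. The start at 0 and the continuity of the
   paths are only required almost surely, because the limiting process [Ylim]
   below is itself only defined almost surely. *)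
Definition brownian_motion (R : realType) (d : measure_display)
    (T : measurableType d) (P : probability T R) (F : R -> set_system T)
    (B : R -> T -> R) : Prop :=
  [/\ adapted F B,
      \forall w \ae P, continuous_path_from0 B w
    & forall s t, 0 <= s -> s < t ->
        independent_systems P (F s) (sigma_rv (fun w => B t w - B s w)) /\
        (forall U : set R, measurable U ->
           pushforward P (fun w => B t w - B s w) U
           = normal_prob 0 (Num.sqrt (t - s)) U)].

(* When tau w = +oo, [fine (tau w)] is irrelevant: the indicator is 0. *)
Definition reflection (R : realType) (T : Type) (B : R -> T -> R)
    (tau : T -> \bar R) (t : R) (w : T) : R :=
  B t w - 2 * (B t w - B (fine (tau w)) w) * ((tau w <= t%:E)%E)%:R.

Definition alpha (R : realType) (eta nu : R) (k : nat) : R :=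
  if k == 0%N then 0 else if odd k then eta else nu.

Definition mix (R : realType) (T : Type) (rho : R) (Bt BY : R -> T -> R)
    (t : R) (w : T) : R :=
  rho * Bt t w + Num.sqrt (1 - rho ^+ 2) * BY t w.

(* inf of an empty set is +oo in the extended reals. *)
Definition next_hit (R : realType) (T : Type) (X Y : R -> T -> R) (a : R)
    (tau : T -> \bar R) (w : T) : \bar R :=
  ereal_inf [set t%:E | t in [set t : R | (tau w <= t%:E)%E /\
                                          X t w - Y t w = a]].

(* The pair (tau_k, \tilde B^k), defined by simultaneous recursion on k. *)
Fixpoint reflection_step (R : realType) (T : Type) (eta nu rho : R)
    (BX BY : R -> T -> R) (k : nat) : (T -> \bar R) * (R -> T -> R) :=
  match k with
  | 0%N => (fun=> 0%E, fun t w => - BX t w)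
  | k'.+1 =>
      let p := reflection_step eta nu rho BX BY k' in
      let tau := next_hit BX (mix rho p.2 BY) (alpha eta nu k) p.1 in
      (tau, reflection p.2 tau)
  end.

Definition tau_ (R : realType) (T : Type) (eta nu rho : R)
    (BX BY : R -> T -> R) (k : nat) : T -> \bar R :=
  (reflection_step eta nu rho BX BY k).1.

Definition Btilde (R : realType) (T : Type) (eta nu rho : R)
    (BX BY : R -> T -> R) (k : nat) : R -> T -> R :=
  (reflection_step eta nu rho BX BY k).2.

Definition Y_ (R : realType) (T : Type) (eta nu rho : R)
    (BX BY : R -> T -> R) (k : nat) : R -> T -> R :=
  mix rho (Btilde eta nu rho BX BY k) BY.

Definition nb_reflections (R : realType) (T : Type) (eta nu rho : R)
    (BX BY : R -> T -> R) (t : R) (w : T) : \bar R :=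
  (\sum_(1 <= n <oo) (((tau_ eta nu rho BX BY n w <= t%:E)%E)%:R)%:E)%E.

(* The number of reflections is a natural number or +oo, and [truncn] of
   [fine] is that natural number in the first case. In the second case, which
   has probability 0, the value is the arbitrary one Y^0. *)
Definition Ylim (R : realType) (T : Type) (eta nu rho : R)
    (BX BY : R -> T -> R) (t : R) (w : T) : R :=
  Y_ eta nu rho BX BY
     (Num.truncn (fine (nb_reflections eta nu rho BX BY t w))) t w.

(* Main.v *)
(* The key invariant is that a reflected process U = \tilde{B}^k and V = B^Y have
   increments over [s, t] that are jointly normal, with independent components,
   conditionally on F_s. It suffices to test it on E (1_A cos (a dU + b dV + c))
   with A in F_s.

   Invariant for (B^X, B^Y): both are Brownian motions for the same filtration,
   but only their independence as processes is assumed. It makes the sums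
   of the products of their increments along a partition of [s, t] small in L^2,
   so that E (1_A dB^X dB^Y) = 0; a B^X + b B^Y is then a martingale with
   increments of known variance and small fourth moment, and a second order
   Taylor expansion of the cosine along a fine partition identifies the
   conditional law of its increments.

   Reflection at a stopping time: flipping the signs of the increments of U
   after tau, along a partition, preserves the invariant because the signs
   are known at the beginning of each step and the cosine transform is even in
   a; by continuity of the paths the flipped sums converge to the increments of
   the reflected process. Each Y^k = rho U + sqrt (1 - rho^2) V is thus a
   Brownian motion, as a law on the real line is determined by its trigonometric
   integrals.

   Finally X - Y^k takes the values nu and eta at consecutive hitting times, and
   its increments there are bounded by those of B^X and B^Y; so the hitting
   times cannot accumulate, every path of Y agrees on [0, t] with that of some
   Y^k, and Y is a limit of Brownian motions. *)
Require Import Defs.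
From HB Require Import structures.
From mathcomp Require Import all_boot all_order all_algebra finmap.
From mathcomp Require Import all_classical all_reals all_analysis.
From mathcomp Require Import measurable_realfun zify ring lra.

Set Implicit Arguments.
Unset Strict Implicit.
Unset Printing Implicit Defensive.

Import Order.TTheory GRing.Theory Num.Theory.
Import numFieldNormedType.Exports.

Local Open Scope classical_set_scope.
Local Open Scope ring_scope.

(** * Expectations of real random variables *)

Section expectation.
Context d (T : measurableType d) (R : realType) (P : probability T R).
Implicit Types f g : T -> R.

(** The obstacle is that F may be larger than the filtration generated by [BX] and [BY]: each
    process has increments independent of F_s, but nothing is assumed about the pair given F_s.
    Independence of the two processes is therefore used only for expectations without the event A:
    the sum of the n products of increments over steps of length h has second moment n V(h) ^ 2 =
    O(1 / n), and the Cauchy-Schwarz inequality then brings 1_A back.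

    Gaussian variances and cosine transforms are never evaluated. They remain abstract functions of
    the length of the increment, and laws are identified by comparison: a B^X + b B^Y and sqrt (a ^
    2 + b ^ 2) B^X obey the same approximate one-step recursion, hence have the same limit.

    The phase c lets real cosines do the work of complex exponentials, since c = - pi / 2 gives the
    sine. It is also what allows c to be replaced by any W known at time s, and so the invariant to
    be chained from one step of a partition to the next. *)

Definition intg f : Prop := P.-integrable setT (EFin \o f).

Definition Ex f : R := \int[P]_w f w.

Lemma intg_measurable f : intg f -> measurable_fun setT f.
Proof. by move=> /measurable_int/measurable_EFinP. Qed.

Lemma intg_le f g : measurable_fun setT f -> intg g ->
  (forall w, `|f w| <= g w) -> intg f.
Proof.
move=> mf ig fg; apply: (le_integrable measurableT _ _ ig).
  exact/measurable_EFinP.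
by move=> w _; rewrite /= lee_fin (le_trans (fg w)) ?ler_norm.
Qed.

Lemma intg_cst k : intg (cst k).
Proof. exact: finite_measure_integrable_cst. Qed.

Lemma intg_bounded f K : measurable_fun setT f ->
  (forall w, `|f w| <= K) -> intg f.
Proof. by move=> mf fK; apply: intg_le mf (intg_cst K) fK. Qed.

Lemma intgD f g : intg f -> intg g -> intg (f \+ g).
Proof. by move=> If Ig; apply: (integrableD measurableT If Ig). Qed.

Lemma intgZ k f : intg f -> intg (fun w => k * f w).
Proof. by move=> If; apply: (integrableZl measurableT k If). Qed.

Lemma intgB f g : intg f -> intg g -> intg (f \- g).
Proof. by move=> If Ig; apply: (integrableB measurableT If Ig). Qed.

Lemma intg_norm f : intg f -> intg (fun w => `|f w|).
Proof. exact: integrable_norm. Qed.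

Lemma ExD f g : intg f -> intg g -> Ex (fun w => f w + g w) = Ex f + Ex g.
Proof. by move=> If Ig; apply: RintegralD. Qed.

Lemma ExB f g : intg f -> intg g -> Ex (fun w => f w - g w) = Ex f - Ex g.
Proof. by move=> If Ig; apply: RintegralB. Qed.

Lemma ExZ k f : intg f -> Ex (fun w => k * f w) = k * Ex f.
Proof. by move=> If; apply: RintegralZl. Qed.

Lemma Ex_cst k : Ex (fun=> k) = k.
Proof. by rewrite /Ex Rintegral_cst//= probability_setT mulr1. Qed.

Lemma Ex_eq f g : f =1 g -> Ex f = Ex g.
Proof. by move=> fg; congr Ex; apply/funext. Qed.

Lemma Ex_ge0 f : (forall w, 0 <= f w) -> 0 <= Ex f.
Proof. by move=> f0; apply: Rintegral_ge0. Qed.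

Lemma Ex_le f g : intg f -> intg g -> (forall w, f w <= g w) -> Ex f <= Ex g.
Proof. by move=> If Ig fg; apply: le_Rintegral. Qed.

Lemma Ex_norm_le f g : measurable_fun setT f -> intg g ->
  (forall w, `|f w| <= g w) -> `|Ex f| <= Ex g.
Proof.
move=> mf Ig fg; have If := intg_le mf Ig fg.
apply: (le_trans (le_normr_Rintegral measurableT If)).
by apply: Ex_le => //; exact: intg_norm.
Qed.

Lemma Ex_indic A : measurable A -> Ex (\1_A) = fine (P A).
Proof. by move=> mA; rewrite /Ex /Rintegral integral_indic// setIT. Qed.

Lemma Ex_cvg (f_ : nat -> T -> R) f g : (forall n, measurable_fun setT (f_ n)) ->
  measurable_fun setT f -> (\forall w \ae P, f_ ^~ w @ \oo --> f w) ->
  intg g -> (forall n w, `|f_ n w| <= g w) -> Ex (f_ n) @[n --> \oo] --> Ex f.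
Proof.
move=> mf_ mf cf ig fg.
have [| | | | |If _ cvgf] := @dominated_convergence _ T R P setT measurableT
  (fun n => EFin \o f_ n) (EFin \o f) (EFin \o g).
- by move=> n; apply/measurable_EFinP.
- exact/measurable_EFinP.
- apply: filterS cf => w cw _; apply: cvg_EFin => //; exact: nearW.
- exact: ig.
- by apply: aeW => w n _; rewrite /= lee_fin.
apply: fine_cvg; rewrite fineK; last exact: integrable_fin_num.
exact: cvgf.
Qed.

Lemma Ex_cvg_bounded (f_ : nat -> T -> R) f K :
  (forall n, measurable_fun setT (f_ n)) ->
  measurable_fun setT f -> (\forall w \ae P, f_ ^~ w @ \oo --> f w) ->
  (forall n w, `|f_ n w| <= K) -> Ex (f_ n) @[n --> \oo] --> Ex f.
Proof. by move=> mf_ mf cf fK; apply: (Ex_cvg mf_ mf cf (intg_cst K)). Qed.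

End expectation.

(** * Functions measurable for a sub-sigma-algebra *)

Section sub_sigma_algebra.
Context (T : pointedType) (R : realType) (G : set_system T).
Hypothesis sG : sigma_algebra setT G.
Implicit Types f g : T -> R.

Definition Gmeas f : Prop := forall U : set R, measurable U -> G (f @^-1` U).

(** A sigma-algebra generates itself, so the closure properties of measurable functions can be
    borrowed from [g_sigma_algebraType G], for each F_t in turn. *)
Lemma GmeasP f :
  Gmeas f <-> measurable_fun setT (f : g_sigma_algebraType G -> R).
Proof.
have GE := measurable_g_measurableTypeE sG.
split=> [Gf _ U mU|mf U mU].
  by rewrite setTI GE; exact: Gf.
by rewrite -GE -[_ @^-1` _]setTI; exact: mf.
Qed.

Lemma Gmeas_comp (h : R -> R) f : measurable_fun setT h -> Gmeas f ->
  Gmeas (h \o f).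
Proof. by move=> mh /GmeasP mf; apply/GmeasP; exact: measurableT_comp. Qed.

Lemma Gmeas_cst k : Gmeas (fun=> k).
Proof. exact/GmeasP/measurable_cst. Qed.

Lemma GmeasD f g : Gmeas f -> Gmeas g -> Gmeas (fun w => f w + g w).
Proof. by move=> /GmeasP mf /GmeasP mg; apply/GmeasP/measurable_funD. Qed.

Lemma GmeasB f g : Gmeas f -> Gmeas g -> Gmeas (fun w => f w - g w).
Proof. by move=> /GmeasP mf /GmeasP mg; apply/GmeasP/measurable_funB. Qed.

Lemma GmeasM f g : Gmeas f -> Gmeas g -> Gmeas (fun w => f w * g w).
Proof. by move=> /GmeasP mf /GmeasP mg; apply/GmeasP/measurable_funM. Qed.

Lemma GmeasZ k f : Gmeas f -> Gmeas (fun w => k * f w).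
Proof. exact: GmeasM (Gmeas_cst k). Qed.

Lemma Gmeas_indic A : G A -> Gmeas (\1_A).
Proof.
move=> GA; apply/GmeasP; apply: measurable_indic.
by rewrite (measurable_g_measurableTypeE sG).
Qed.

Lemma G_setI A B : G A -> G B -> G (A `&` B).
Proof.
rewrite -(measurable_g_measurableTypeE sG) => mA mB; exact: measurableI.
Qed.

Lemma G_setC A : G A -> G (~` A).
Proof. by rewrite -(measurable_g_measurableTypeE sG) => /measurableC. Qed.

Lemma G_setT : G setT.
Proof. by rewrite -(measurable_g_measurableTypeE sG); exact: measurableT. Qed.

Lemma G_bigcup (I : Type) (A : I -> set T) :
  countable [set: I] -> (forall i, G (A i)) -> G (\bigcup_i A i).
Proof.
rewrite -(measurable_g_measurableTypeE sG) => cI GA.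
exact: countable_bigcupT_measurable.
Qed.

End sub_sigma_algebra.

(** * Constant conditional expectations *)

Section projection.
Import HBSimple HBNNSimple.
Context d (T : measurableType d) (R : realType) (P : probability T R).
Context (G : set_system T) (sG : sigma_algebra setT G).
Hypothesis Gm : G `<=` measurable.
Implicit Types f g xi : T -> R.

Lemma Gmeas_measurable f : Gmeas G f -> measurable_fun setT f.
Proof. by move=> Gf _ U mU; rewrite setTI; apply: Gm; exact: Gf. Qed.

Variables (g : T -> R) (k : R).
Hypothesis ig : intg P g.
(* The conditional expectation of g given G is the constant k *)
Hypothesis gE : forall A, G A -> Ex P (fun w => \1_A w * g w) = k * fine (P A).

Let E_seq (I : Type) (s : seq I) (a : I -> R) (A : I -> set T) :
  (forall i, G (A i)) ->
  intg P (fun w => (\sum_(i <- s) a i * \1_(A i) w) * g w) /\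
  Ex P (fun w => (\sum_(i <- s) a i * \1_(A i) w) * g w) =
  k * Ex P (fun w => \sum_(i <- s) a i * \1_(A i) w).
Proof.
move=> GA.
have iA i : intg P (\1_(A i)).
  by apply: integrable_indic; exact/Gm/GA.
have iAg i : intg P (fun w => \1_(A i) w * g w).
  apply: (intg_le _ (intg_norm ig)).
    apply: measurable_funM; last exact: intg_measurable ig.
    exact: intg_measurable (iA i).
  by move=> w; rewrite normrM ler_piMl// indicE; case: (_ \in _);
    rewrite ?normr1 ?normr0.
have iAs (t : seq I) : intg P (fun w => \sum_(i <- t) a i * \1_(A i) w).
  elim: t => [|i t It].
    by under eq_fun do rewrite big_nil; exact: intg_cst.
  under eq_fun do rewrite big_cons.
  by apply: intgD => //; exact: intgZ.
elim: s => [|i s [Is Es]].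
  under eq_fun do rewrite big_nil mul0r.
  split; first exact: intg_cst.
  by under [in RHS]eq_fun do rewrite big_nil; rewrite !Ex_cst mulr0.
under eq_fun do rewrite big_cons mulrDl -mulrA.
under [in RHS]eq_fun do rewrite big_cons.
split; first by apply: intgD => //; exact: intgZ.
rewrite ExD//; last exact: intgZ.
rewrite ExD//; last exact: intgZ.
rewrite !ExZ// gE// Es Ex_indic; last exact/Gm/GA.
ring.
Qed.

(** The approximating simple functions are built over [g_sigma_algebraType G], so that their level
    sets lie in [G]; the limit is dominated by [xi] and by the absolute value of [xi * g]. *)
Let E_ge0 xi : Gmeas G xi -> (forall w, 0 <= xi w) -> intg P xi ->
  intg P (fun w => xi w * g w) -> Ex P (fun w => xi w * g w) = k * Ex P xi.
Proof.
move=> Gxi xi0 ixi ixig.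
pose TG : measurableType _ := g_sigma_algebraType G.
have mxi : measurable_fun [set: TG] (EFin \o (xi : TG -> R)).
  by apply/measurable_EFinP/(GmeasP sG).
pose xs := nnsfun_approx measurableT mxi.
pose x_ (n : nat) (w : T) : R := xs n w.
have x_cvg w : x_ ^~ w @ \oo --> xi w.
  apply: (@fine_cvg _ _ _ _ (fun n => (xs n w)%:E) (xi w)).
  by apply: (@cvg_nnsfun_approx _ _ _ _ measurableT _ mxi) => // t _; rewrite lee_fin.
have x_ge0 n w : 0 <= x_ n w by apply: fun_ge0.
have x_le n w : x_ n w <= xi w.
  rewrite -lee_fin /x_ /xs nnsfun_approxE.
  by apply: (@le_approx _ _ _ setT) => // t _; rewrite lee_fin.
have GA n (y : R) : G (x_ n @^-1` [set y]).
  rewrite -(measurable_g_measurableTypeE sG).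
  by rewrite -[X in measurable X]setTI; apply: measurable_funP.
have x_E n w : x_ n w =
    \sum_(y <- fset_set (range (x_ n))) y * \1_(x_ n @^-1` [set y]) w.
  by have := fimfunE (xs n) w; rewrite fsbig_finite.
have x_G n : Gmeas G (x_ n) by apply/(GmeasP sG); exact: measurable_funP.
have mx n := Gmeas_measurable (x_G n).
have mg := intg_measurable ig.
have c1 : Ex P (fun w => x_ n w * g w) @[n --> \oo] --> Ex P (fun w => xi w * g w).
  apply: (Ex_cvg _ _ _ (intg_norm ixig)).
  - by move=> n; apply: measurable_funM.
  - exact: intg_measurable ixig.
  - by apply: aeW => w; apply: cvgM; [exact: x_cvg|exact: cvg_cst].
  - move=> n w; rewrite !normrM ler_wpM2r// !ger0_norm//.
have c2 : Ex P (x_ n) @[n --> \oo] --> Ex P xi.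
  apply: (Ex_cvg _ _ _ ixi).
  - by move=> n.
  - exact: intg_measurable ixi.
  - by apply: aeW => w; exact: x_cvg.
  - by move=> n w; rewrite ger0_norm.
have e n : Ex P (fun w => x_ n w * g w) = k * Ex P (x_ n).
  rewrite (Ex_eq P (x_E n)).
  rewrite (Ex_eq P (g := fun w => (\sum_(y <- fset_set (range (x_ n)))
    y * \1_(x_ n @^-1` [set y]) w) * g w)); last by move=> w; rewrite x_E.
  exact: (E_seq _ _ (GA n)).2.
have c3 : Ex P (fun w => x_ n w * g w) @[n --> \oo] --> k * Ex P xi.
  by under eq_cvg do rewrite e; apply: cvgM; [exact: cvg_cst|exact: c2].
exact: (cvg_unique (@Rhausdorff R) c1 c3).
Qed.

(** Every conditional expectation met below is a constant k, so none has to be constructed: the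
    identity on events extends to factors measurable for [G] through positive and negative parts. *)
Lemma Ex_projection xi : Gmeas G xi -> intg P xi ->
  intg P (fun w => xi w * g w) -> Ex P (fun w => xi w * g w) = k * Ex P xi.
Proof.
move=> Gxi ixi ixig.
pose p w := Num.max (xi w) 0; pose q w := Num.max (- xi w) 0.
have Gp : Gmeas G p.
  apply/(GmeasP sG)/measurable_maxr; [exact/(GmeasP sG)|exact: measurable_cst].
have Gq : Gmeas G q.
  apply/(GmeasP sG)/measurable_maxr; last exact: measurable_cst.
  by apply: measurableT_comp => //; exact/(GmeasP sG).
have xiE w : xi w = p w - q w.
  by rewrite /p /q !maxEle; case: leP => ?; case: leP => ?; lra.
have p_le w : `|p w| <= `|xi w|.
  by rewrite /p maxEle; case: (leP (xi w) 0) => ?; rewrite ?normr0//.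
have q_le w : `|q w| <= `|xi w|.
  by rewrite /q maxEle; case: (leP (- xi w) 0) => ?; rewrite ?normr0 ?normrN//.
have mg := intg_measurable ig.
have ii (z : T -> R) : Gmeas G z -> (forall w, `|z w| <= `|xi w|) ->
    intg P z /\ intg P (fun w => z w * g w).
  move=> Gz zx; have mz := Gmeas_measurable Gz; split.
    exact: intg_le mz (intg_norm ixi) zx.
  apply: intg_le (intg_norm ixig) _; first exact: measurable_funM.
  by move=> w; rewrite !normrM ler_wpM2r.
have [ip ipg] := ii _ Gp p_le.
have [iq iqg] := ii _ Gq q_le.
under eq_fun do rewrite xiE mulrBl.
rewrite (Ex_eq P xiE).
rewrite !ExB// !E_ge0//; first ring.
- by move=> w; rewrite /q le_max lexx orbT.
- by move=> w; rewrite /p le_max lexx orbT.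
Qed.

End projection.

(** * The normal law: density, symmetry, fourth moment *)

Section normal_law.
Context (R : realType).
Notation mu := (@lebesgue_measure R).

(** The density and the Radon-Nikodym derivative have the same integral over every measurable set,
    hence agree almost everywhere. *)
Lemma ge0_integral_normal_prob (s : R) (f : R -> \bar R) : s != 0 ->
  measurable_fun setT f -> (forall x, 0 <= f x)%E ->
  (\int[normal_prob 0 s]_x f x =
   \int[mu]_x (f x * (normal_pdf 0 s x)%:E))%E.
Proof.
move=> s0 mf f0.
have dom : normal_prob 0 s `<< mu by exact: normal_prob_dominates.
have mRN : mu.-integrable setT
    (Radon_Nikodym_SigmaFinite.f (normal_prob 0 s) mu).
  exact: Radon_Nikodym_SigmaFinite.f_integrable.
rewrite -(Radon_Nikodym_SigmaFinite.change_of_variables dom)//.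
apply: ae_eq_integral => //.
- by apply: emeasurable_funM => //; exact: measurable_int mRN.
- apply: emeasurable_funM => //; apply/measurable_EFinP.
  exact: measurable_normal_pdf.
- apply: ae_eqe_mul2l; apply: integral_ae_eq => //.
    by apply/measurable_EFinP; exact: measurable_normal_pdf.
  by move=> E _ mE; rewrite -Radon_Nikodym_SigmaFinite.f_integral.
Qed.

Lemma normal_probN (s : R) (U : set R) : s != 0 -> measurable U ->
  normal_prob 0 s (-%R @^-1` U) = normal_prob 0 s U.
Proof.
move=> s0 mU; rewrite /normal_prob.
have pdfN x : normal_pdf 0 s (- x) = normal_pdf 0 s x.
  by rewrite !normal_pdfE// /normal_fun !subr0 sqrrN.
under [LHS]eq_integral do rewrite -pdfN.
have mpdf : measurable_fun U (EFin \o normal_pdf 0 s).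
  by apply/measurable_EFinP/measurable_funTS; exact: measurable_normal_pdf.
have mN : measurable_fun setT (-%R : measurableTypeR R -> measurableTypeR R).
  exact: oppr_measurable.
transitivity (\int[pushforward mu (-%R : measurableTypeR R -> measurableTypeR R)]_(x in U)
    (normal_pdf 0 s x)%:E)%E.
  rewrite (ge0_integral_pushforward mN mu mU mpdf)// => y _.
  by rewrite lee_fin normal_pdf_ge0.
by apply: eq_measure_integral => A mA AU; exact: lebesgue_measureN.
Qed.

(* Domination by a normal density of larger variance bounds the fourth moment
   without computing it; 128 is not sharp *)
Lemma normal_pdf_fourth (s x : R) : s != 0 ->
  x ^+ 4 * normal_pdf 0 s x <= 128 * s ^+ 4 * normal_pdf 0 (2 * s) x.
Proof.
move=> s0; have s20 : 2 * s != 0 by rewrite mulf_neq0.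
rewrite !normal_pdfE// /normal_fun subr0.
have -> : normal_peak (2 * s) = normal_peak s / 2.
  rewrite /normal_peak -[in RHS]invfM; congr (_ ^-1).
  rewrite (_ : (2 * s) ^+ 2 * pi *+ 2 = 2 ^+ 2 * (s ^+ 2 * pi *+ 2)); last first.
    by rewrite exprMn -mulrA mulrnAr.
  by rewrite sqrtrM ?sqr_ge0// sqrtr_sqr ger0_norm// mulrC.
(* The exponents of the wide and of the narrow density are - z and - 4 z. As x ^ 4 = 64 s ^ 4 z ^ 2
   and the peaks are in ratio 2, the claim amounts to z ^ 2 exp (- 3 z) <= 1, which follows from (1
   + z) exp (- z) <= 1. *)
pose z := x ^+ 2 / (8 * s ^+ 2).
have s2 : 0 < s ^+ 2 by rewrite exprn_even_gt0.
have z0 : 0 <= z by rewrite divr_ge0 ?sqr_ge0// mulr_ge0// ltW.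
have -> : - x ^+ 2 / (s ^+ 2 *+ 2) = - z + (- z + (- z + - z)).
  by rewrite /z; field.
have -> : - x ^+ 2 / ((2 * s) ^+ 2 *+ 2) = - z.
  by rewrite /z; field.
have -> : x ^+ 4 = 64 * s ^+ 4 * z ^+ 2.
  by rewrite /z; field.
rewrite !expRD; set e := expR (- z).
have e0 : 0 <= e by exact: expR_ge0.
have ze : (1 + z) * e <= 1.
  by rewrite -[leRHS](expRxMexpNx_1 z) ler_wpM2r// expR_ge1Dx.
have zze : z ^+ 2 * e ^+ 3 <= 1.
  have e1 : e <= 1 by nra.
  have ze0 : 0 <= z * e by exact: mulr_ge0.
  have ze1 : z * e <= 1 by nra.
  rewrite (_ : z ^+ 2 * e ^+ 3 = (z * e) ^+ 2 * e); last ring.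
  by rewrite mulr_ile1 ?exprn_ile1 ?exprn_ge0.
have p0 := normal_peak_ge0 s.
have s40 : 0 <= s ^+ 4 by rewrite exprn_even_ge0.
have : 0 <= 64 * s ^+ 4 * normal_peak s * e * (1 - z ^+ 2 * e ^+ 3).
  have a1 : 0 <= 64 * s ^+ 4 by rewrite pmulr_rge0.
  by apply: (mulr_ge0 (mulr_ge0 (mulr_ge0 a1 p0) e0)); rewrite subr_ge0.
lra.
Qed.

Lemma normal_fourth_moment (s : R) : s != 0 ->
  (\int[normal_prob 0 s]_x (x ^+ 4)%:E <= (128 * s ^+ 4)%:E)%E.
Proof.
move=> s0; have s20 : 2 * s != 0 by rewrite mulf_neq0.
have m4 : measurable_fun setT (fun x : R => x ^+ 4) by exact: measurable_funX.
have x4 (x : R) : 0 <= x ^+ 4 by rewrite exprn_even_ge0.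
rewrite ge0_integral_normal_prob//; last exact/measurable_EFinP.
have mp t : measurable_fun setT (normal_pdf 0 t : R -> R).
  exact: measurable_normal_pdf.
apply: (@le_trans _ _
    (\int[mu]_x ((128 * s ^+ 4)%:E * (normal_pdf 0 (2 * s) x)%:E))%E).
  apply: ge0_le_integral => //.
  - by move=> x _; rewrite -EFinM lee_fin mulr_ge0// normal_pdf_ge0.
  - by apply/measurable_EFinP; exact: (measurable_funM m4 (mp s)).
  - apply/measurable_EFinP.
    exact: (measurable_funM (measurable_cst (128 * s ^+ 4)) (mp (2 * s))).
  - by move=> x _; rewrite -!EFinM lee_fin normal_pdf_fourth.
rewrite integralZl//; last exact: integrable_normal_pdf.
by rewrite integral_normal_pdf mule1.
Qed.

End normal_law.

(** * Integrals against the law of a variable; normal variables *)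

Section law.
Context d (T : measurableType d) (R : realType) (P : probability T R).

Definition has_law (X : T -> measurableTypeR R) (m : probability (measurableTypeR R) R) : Prop :=
  measurable_fun setT X /\
  forall U, measurable U -> P (X @^-1` U) = m U.

Lemma has_law_integral (X : T -> measurableTypeR R)
    (m : probability (measurableTypeR R) R) (f : measurableTypeR R -> R) : has_law X m ->
  measurable_fun setT f ->
  m.-integrable setT (EFin \o f) ->
  intg P (f \o X) /\ Ex P (f \o X) = \int[m]_x f x.
Proof.
move=> [mX Xm] mf intf.
have mEf : measurable_fun setT (EFin \o f) by exact/measurable_EFinP.
have law g : (\int[pushforward P X]_x g x = \int[m]_x g x)%E.
  by apply: eq_measure_integral => A mA _; exact: Xm.
have If : intg P (f \o X).
  apply/integrableP; split; first exact/measurable_EFinP/measurableT_comp.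
  move/integrableP : intf => [_]; rewrite -law ge0_integral_pushforward//.
  by do 2 apply: measurableT_comp => //.
split => //.
rewrite /Ex /Rintegral -law integral_pushforward//.
Qed.

End law.

Section normal_variable.
Context d (T : measurableType d) (R : realType) (P : probability T R).
Implicit Types X : T -> R.

Definition normal_law X (h : R) : Prop := has_law P X (normal_prob 0 (Num.sqrt h)).

(* Only variance_normal h = O(h) is needed; neither its value h nor the value
   expR (- h * q / 2) of cos_normal h q is ever computed *)
Definition variance_normal (h : R) : R :=
  \int[normal_prob 0 (Num.sqrt h)]_x (x ^+ 2).

Definition cos_normal (h q : R) : R :=
  \int[normal_prob 0 (Num.sqrt h)]_x cos (Num.sqrt q * x).

Let fourth_integrable (h : R) : 0 < h ->
  (normal_prob 0 (Num.sqrt h)).-integrable setT (EFin \o (fun x : R => x ^+ 4)).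
Proof.
move=> h0; have s0 : Num.sqrt h != 0 by rewrite gt_eqF// sqrtr_gt0.
apply/integrableP; split; first exact/measurable_EFinP/measurable_funX.
apply: (@le_lt_trans _ _ (128 * Num.sqrt h ^+ 4)%:E); last exact: ltry.
apply: le_trans (normal_fourth_moment s0).
rewrite le_eqVlt; apply/orP; left; apply/eqP/eq_integral => x _.
by rewrite /= ger0_norm// exprn_even_ge0.
Qed.

Lemma normal_law_moment4 X (h : R) : 0 < h -> normal_law X h ->
  intg P (fun w => X w ^+ 4) /\ Ex P (fun w => X w ^+ 4) <= 128 * h ^+ 2.
Proof.
move=> h0 XN; have s0 : Num.sqrt h != 0 by rewrite gt_eqF// sqrtr_gt0.
have m4 : measurable_fun setT (fun x : R => x ^+ 4) by exact: measurable_funX.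
have [IX EX] := has_law_integral XN m4 (fourth_integrable h0).
split => //; rewrite [leLHS]EX.
have := normal_fourth_moment s0.
rewrite (_ : 128 * h ^+ 2 = 128 * Num.sqrt h ^+ 4); last first.
  by rewrite (exprM _ 2 2) sqr_sqrtr// ltW.
by rewrite -lee_fin fineK// (integrable_fin_num _ (fourth_integrable h0)).
Qed.

Lemma normal_lawN X (h : R) : 0 < h -> normal_law X h -> normal_law (fun w => - X w) h.
Proof.
move=> h0 [mX XN]; have s0 : Num.sqrt h != 0 by rewrite gt_eqF// sqrtr_gt0.
split; first exact: measurableT_comp.
move=> U mU; rewrite /= -[RHS](normal_probN s0 mU) -XN//.
by rewrite -[X in measurable X]setTI; exact: oppr_measurable.
Qed.

Lemma le_fourth (x : R) : `|x| <= 1 + x ^+ 4 /\ x ^+ 2 <= 1 + x ^+ 4.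
Proof.
have x2 := sqr_ge0 x; have x21 := sqr_ge0 (x ^+ 2 - 1).
have xx := sqr_ge0 (`|x| - 1).
have : x ^+ 4 = (x ^+ 2) ^+ 2 by ring.
have : `|x| ^+ 2 = x ^+ 2 by rewrite real_normK ?num_real.
split; nra.
Qed.

(** X and - X have the same law. *)
Lemma normal_law_Ex1 X (h : R) : 0 < h -> normal_law X h -> Ex P X = 0.
Proof.
move=> h0 XN.
have m1 : measurable_fun setT (fun x : R => x) by exact: measurable_id.
have i1 : (normal_prob 0 (Num.sqrt h)).-integrable setT (EFin \o (fun x : R => x)).
  apply: (@intg_le _ _ _ (normal_prob 0 (Num.sqrt h)) _ (fun x => 1 + x ^+ 4)) => //.
    apply: intgD; [exact: intg_cst|exact: fourth_integrable].
  by move=> x; case: (le_fourth x).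
have [IX EX] := has_law_integral XN m1 i1.
have [_ EXN] := has_law_integral (normal_lawN h0 XN) m1 i1.
have : Ex P (fun w => - X w) = - Ex P X.
  by under eq_fun do rewrite -mulN1r; rewrite ExZ// mulN1r.
have -> : Ex P (fun w => - X w) = Ex P X by rewrite [LHS]EXN [RHS]EX.
lra.
Qed.

Let square_integrable (h : R) : 0 < h ->
  (normal_prob 0 (Num.sqrt h)).-integrable setT (EFin \o (fun x : R => x ^+ 2)).
Proof.
move=> h0.
apply: (@intg_le _ _ _ (normal_prob 0 (Num.sqrt h)) _ (fun x => 1 + x ^+ 4)) => //.
- by apply: intgD; [exact: intg_cst|exact: fourth_integrable].
- by move=> x; rewrite ger0_norm ?sqr_ge0//; case: (le_fourth x).
Qed.

Lemma normal_law_Ex2 X (h : R) : 0 < h -> normal_law X h ->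
  Ex P (fun w => X w ^+ 2) = variance_normal h.
Proof.
move=> h0 XN.
have m2 : measurable_fun setT (fun x : R => x ^+ 2) by exact: measurable_funX.
by have [_ EX] := has_law_integral XN m2 (square_integrable h0).
Qed.

(** The inequality x ^ 2 <= h + x ^ 4 / h reduces the second moment to the fourth, whence 129 = 1 +
    128. *)
Lemma variance_normal_le (h : R) : 0 < h -> 0 <= variance_normal h <= 129 * h.
Proof.
move=> h0; apply/andP; split; first by apply: Rintegral_ge0 => x _; exact: sqr_ge0.
have s0 : Num.sqrt h != 0 by rewrite gt_eqF// sqrtr_gt0.
pose N := normal_prob 0 (Num.sqrt h) : probability (measurableTypeR R) R.
have i4 : intg N (fun x : R => x ^+ 4) by exact: fourth_integrable.
have e4 : Ex N (fun x : R => x ^+ 4) <= 128 * h ^+ 2.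
  have := normal_fourth_moment s0.
  rewrite (_ : 128 * h ^+ 2 = 128 * Num.sqrt h ^+ 4); last first.
    by rewrite (exprM _ 2 2) sqr_sqrtr// ltW.
  by rewrite -lee_fin fineK//; exact: (integrable_fin_num _ i4).
have ig : intg N (fun x : R => h + h^-1 * x ^+ 4).
  by apply: intgD; [exact: intg_cst|exact: intgZ].
have : Ex N (fun x : R => x ^+ 2) <= Ex N (fun x : R => h + h^-1 * x ^+ 4).
  apply: Ex_le => //; first exact: square_integrable.
  move=> x; have : h^-1 * x ^+ 4 = (x ^+ 2) * (x ^+ 2 / h).
    by field; rewrite gt_eqF.
  move=> ->; have [xh|hx] := leP (x ^+ 2) h.
    by rewrite ler_wpDr// mulr_ge0 ?divr_ge0 ?sqr_ge0// ltW.
  rewrite (le_trans (y := x ^+ 2 * (x ^+ 2 / h)))//; last by rewrite lerDr ltW.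
  by rewrite ler_peMr ?sqr_ge0// ler_pdivlMr// mul1r ltW.
rewrite ExD; [|exact: intg_cst|exact: intgZ].
rewrite Ex_cst ExZ// => /le_trans; apply.
have : h^-1 * Ex N (fun x : R => x ^+ 4) <= h^-1 * (128 * h ^+ 2).
  by rewrite ler_wpM2l// invr_ge0 ltW.
rewrite (_ : h^-1 * (128 * h ^+ 2) = 128 * h); last by field; rewrite gt_eqF.
lra.
Qed.

Lemma normal_law_cos X (h q : R) : normal_law X h ->
  Ex P (fun w => cos (Num.sqrt q * X w)) = cos_normal h q.
Proof.
move=> XN.
have mc : measurable_fun setT (fun x : R => cos (Num.sqrt q * x)).
  apply: (@measurableT_comp _ _ _ _ _ _ cos); last exact: measurable_funM.
  by apply: continuous_measurable_fun; exact: continuous_cos.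
have ic : (normal_prob 0 (Num.sqrt h)).-integrable setT
    (EFin \o (fun x : R => cos (Num.sqrt q * x))).
  apply: (@intg_bounded _ _ _ (normal_prob 0 (Num.sqrt h)) _ 1) => // x.
  by rewrite ler_norml cos_geN1 cos_le1.
by have [_ EX] := has_law_integral XN mc ic.
Qed.

End normal_variable.

(** * Second order expansion of the cosine *)

Section taylor.
Context (R : realType).
Implicit Types x y z : R.

(** Meant to be iterated: the nonnegative expression in each of the next four inequalities is the
    derivative of the following one. *)
Lemma ge0_of_derive (f f' : R -> R) : (forall x, is_derive x 1 f (f' x)) ->
  f 0 = 0 -> (forall x, 0 <= x -> 0 <= f' x) -> forall x, 0 <= x -> 0 <= f x.
Proof.
move=> df f0 f'0 x; rewrite le_eqVlt => /predU1P[<-|x0]; first by rewrite f0.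
have [|c] := @MVT R f f' 0 x x0 (fun y _ => df y).
  apply: derivable_within_continuous => y _.
  exact: (@ex_derive _ _ _ _ _ _ _ (df y)).
rewrite in_itv/= => /andP[c0 _]; rewrite f0 !subr0 => ->.
by rewrite mulr_ge0 ?f'0// ltW.
Qed.

Lemma sin_le_id x : 0 <= x -> sin x <= x.
Proof.
move=> x0; rewrite -subr_ge0; move: x x0.
apply: (@ge0_of_derive _ (fun x => 1 - cos x)).
- by rewrite sin0 subrr.
- by move=> x _; rewrite subr_ge0 cos_le1.
Qed.

Lemma cos_ge_quad x : 0 <= x -> 0 <= cos x - 1 + x ^+ 2 / 2.
Proof.
move: x; apply: (@ge0_of_derive _ (fun x => - sin x + x)).
- move=> x; apply: is_derive_eq.
  by rewrite /GRing.scale/=; field.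
- by rewrite cos0; ring.
- by move=> x x0; rewrite addrC subr_ge0 sin_le_id.
Qed.

Lemma sin_ge_cub x : 0 <= x -> 0 <= sin x - x + x ^+ 3 / 6.
Proof.
move: x; apply: (@ge0_of_derive _ (fun x => cos x - 1 + x ^+ 2 / 2)).
- move=> x; apply: is_derive_eq.
  by rewrite /GRing.scale/=; field.
- by rewrite sin0; ring.
- exact: cos_ge_quad.
Qed.

Lemma cos_le_quart x : 0 <= x -> 0 <= x ^+ 4 / 24 - (cos x - 1 + x ^+ 2 / 2).
Proof.
move: x; apply: (@ge0_of_derive _ (fun x => sin x - x + x ^+ 3 / 6)).
- move=> x; apply: is_derive_eq.
  by rewrite /GRing.scale/=; field.
- by rewrite cos0; ring.
- exact: sin_ge_cub.
Qed.

(** The natural remainder is of order |z| ^ 3, but only second and fourth moments of increments are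
    controlled. The square (k |z| - 1) ^ 2 >= 0 trades the cube for these two powers, with a weight
    k left free so that both errors can be made small. *)
Lemma cos_taylor (k y z : R) : 1 <= k ->
  `|cos (y + z) - cos y + z * sin y + z ^+ 2 / 2 * cos y| <=
  z ^+ 2 / k + k * z ^+ 4.
Proof.
move=> k1; have k0 : 0 < k by lra.
have cz : `|cos z - 1 + z ^+ 2 / 2| <= z ^+ 4 / 24.
  wlog z0 : z / 0 <= z => [hw|].
    have [/hw//|/ltW z0] := leP 0 z.
    by have := hw (- z); rewrite cosN sqrrN (_ : (- z) ^+ 4 = z ^+ 4) ?oppr_ge0; [apply|ring].
  have := cos_ge_quad z0; have := cos_le_quart z0.
  by rewrite ler_norml; lra.
have sz : `|sin z - z| <= `|z| ^+ 3 / 6.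
  wlog z0 : z {cz} / 0 <= z => [hw|].
    have [/hw//|/ltW z0] := leP 0 z.
    have := hw (- z); rewrite sinN normrN -opprB opprK normrN addrC.
    by rewrite oppr_ge0 addrC; apply.
  have := sin_le_id z0; have := sin_ge_cub z0.
  by rewrite ler_norml (ger0_norm z0); lra.
have -> : cos (y + z) - cos y + z * sin y + z ^+ 2 / 2 * cos y =
    cos y * (cos z - 1 + z ^+ 2 / 2) - sin y * (sin z - z).
  by rewrite cosD; ring.
apply: (le_trans (ler_normB _ _)); rewrite !normrM.
have c1 : `|cos y| <= 1 by rewrite ler_norml cos_geN1 cos_le1.
have s1 : `|sin y| <= 1 by rewrite ler_norml sin_geN1 sin_le1.
have : `|cos y| * `|cos z - 1 + z ^+ 2 / 2| <= z ^+ 4 / 24.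
  by rewrite -[leRHS]mul1r ler_pM.
have : `|sin y| * `|sin z - z| <= `|z| ^+ 3 / 6.
  by rewrite -[leRHS]mul1r ler_pM.
have nz2 : `|z| ^+ 2 = z ^+ 2 by rewrite real_normK ?num_real.
have z3 : `|z| ^+ 3 <= z ^+ 2 / k + k * z ^+ 4.
  pose i := k^-1; have ki : k * i = 1 by rewrite divff// gt_eqF.
  have i0 : 0 <= i by rewrite invr_ge0 ltW.
  have z4 : z ^+ 4 = `|z| ^+ 4 by rewrite !(exprM _ 2 2) nz2.
  have := mulr_ge0 (mulr_ge0 i0 (sqr_ge0 `|z|)) (sqr_ge0 (k * `|z| - 1)).
  have -> : i * `|z| ^+ 2 * (k * `|z| - 1) ^+ 2 = (k * i) * k * `|z| ^+ 4
     - 2 * (k * i) * `|z| ^+ 3 + z ^+ 2 / k.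
    by rewrite -nz2 /i; ring.
  rewrite ki z4 !mul1r mulr1 => ?.
  have : 0 <= `|z| ^+ 3 by rewrite exprn_ge0.
  lra.
have z4 : 0 <= z ^+ 4 by rewrite exprn_even_ge0.
have : z ^+ 4 <= k * z ^+ 4 by rewrite ler_peMl.
have : 0 <= z ^+ 2 / k by rewrite divr_ge0 ?sqr_ge0// ltW.
lra.
Qed.

End taylor.

(** * Variables with a finite fourth moment *)

Section fourth_power_integrable.
Context d (T : measurableType d) (R : realType) (P : probability T R).
Implicit Types f g : T -> R.

(** Four is the number of increments multiplied together in the second moment of a sum of products
    dX dY. *)
Definition L4 f : Prop :=
  measurable_fun setT f /\ intg P (fun w => f w ^+ 4).

Lemma L4_cst k : L4 (fun=> k).
Proof. by split; [exact: measurable_cst|exact: intg_cst]. Qed.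

Lemma L4_bounded f K : measurable_fun setT f -> (forall w, `|f w| <= K) -> L4 f.
Proof.
move=> mf fK; split => //; apply: (@intg_bounded _ _ _ _ _ (K ^+ 4)).
  exact: measurable_funX.
by move=> w; rewrite normrX lerXn2r// nnegrE// (le_trans _ (fK w)).
Qed.

Lemma L4Z k f : L4 f -> L4 (fun w => k * f w).
Proof.
move=> [mf f4]; split; first exact: measurable_funM.
by under eq_fun do rewrite exprMn; exact: intgZ.
Qed.

Lemma quartic_add (x y : R) : (x + y) ^+ 4 <= 8 * x ^+ 4 + 8 * y ^+ 4.
Proof.
have h1 (a b : R) : (a + b) ^+ 2 <= 2 * a ^+ 2 + 2 * b ^+ 2.
  by have := sqr_ge0 (a - b); lra.
have h2 := h1 x y; have h3 := h1 (x ^+ 2) (y ^+ 2).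
have q (a : R) : a ^+ 4 = (a ^+ 2) ^+ 2 by rewrite -exprM.
have u0 := sqr_ge0 (x + y); have x0 := sqr_ge0 x; have y0 := sqr_ge0 y.
rewrite !q; nra.
Qed.

Lemma L4D f g : L4 f -> L4 g -> L4 (fun w => f w + g w).
Proof.
move=> [mf f4] [mg g4]; have mfg := measurable_funD mf mg; split => //.
apply: (intg_le _ (intgD (intgZ 8 f4) (intgZ 8 g4))).
  exact: measurable_funX.
by move=> w; rewrite ger0_norm ?exprn_even_ge0//; exact: quartic_add.
Qed.

Lemma quartic_prod (a b c e : R) :
  `|a * b * c * e| <= a ^+ 4 + b ^+ 4 + c ^+ 4 + e ^+ 4.
Proof.
have h (x y : R) : `|x * y| <= (x ^+ 2 + y ^+ 2) / 2.
  by rewrite ler_norml; have := sqr_ge0 (x - y); have := sqr_ge0 (x + y); lra.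
have q (x : R) : x ^+ 4 = (x ^+ 2) ^+ 2 by rewrite -exprM.
have := h (a * b) (c * e); rewrite !mulrA !q !exprMn.
have := h (a ^+ 2) (b ^+ 2); have := h (c ^+ 2) (e ^+ 2).
rewrite (ger0_norm (mulr_ge0 (sqr_ge0 a) (sqr_ge0 b))).
rewrite (ger0_norm (mulr_ge0 (sqr_ge0 c) (sqr_ge0 e))).
have := sqr_ge0 (a ^+ 2); have := sqr_ge0 (b ^+ 2).
have := sqr_ge0 (c ^+ 2); have := sqr_ge0 (e ^+ 2).
lra.
Qed.

Lemma L4_prod4 f g h k : L4 f -> L4 g -> L4 h -> L4 k ->
  intg P (fun w => f w * g w * h w * k w).
Proof.
move=> [mf f4] [mg g4] [mh h4] [mk k4].
apply: (intg_le _ (intgD (intgD (intgD f4 g4) h4) k4)).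
  by do 3 apply: measurable_funM => //.
by move=> w; exact: quartic_prod.
Qed.

Lemma L4_prod3 f g h : L4 f -> L4 g -> L4 h -> intg P (fun w => f w * g w * h w).
Proof.
move=> Lf Lg Lh; have := L4_prod4 Lf Lg Lh (L4_cst 1).
by under eq_fun do rewrite mulr1.
Qed.

Lemma L4_prod2 f g : L4 f -> L4 g -> intg P (fun w => f w * g w).
Proof.
move=> Lf Lg; have := L4_prod3 Lf Lg (L4_cst 1).
by under eq_fun do rewrite mulr1.
Qed.

Lemma L4_intg f : L4 f -> intg P f.
Proof.
move=> Lf; have := L4_prod2 Lf (L4_cst 1).
by under eq_fun do rewrite mulr1.
Qed.

Lemma L4_indic A : measurable A -> L4 (\1_A).
Proof.
move=> mA; apply: (@L4_bounded _ 1); first exact: measurable_indic.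
by move=> w; rewrite indicE; case: (_ \in _); rewrite ?normr1 ?normr0.
Qed.

Lemma L4_indicM A f : measurable A -> L4 f -> L4 (fun w => \1_A w * f w).
Proof.
move=> mA [mf f4]; have mAf := measurable_funM (measurable_indic mA) mf.
split => //; apply: (intg_le _ f4); first exact: measurable_funX.
move=> w; rewrite ger0_norm ?exprn_even_ge0// exprMn.
by rewrite ler_piMl ?exprn_even_ge0.
Qed.

End fourth_power_integrable.

(** * Independence and products of expectations *)

Section independence.
Context d (T : measurableType d) (R : realType) (P : probability T R).
Implicit Types G H : set_system T.

(** Two projections: given [H], the indicator of an event A of [G] has conditional expectation P A;
    hence, given [G], [g] has conditional expectation [Ex P g]. *)
Lemma Ex_indep G H (xi g : T -> R) :
  sigma_algebra setT G -> G `<=` measurable ->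
  sigma_algebra setT H -> H `<=` measurable ->
  independent_systems P G H -> Gmeas G xi -> Gmeas H g ->
  intg P xi -> intg P g -> intg P (fun w => xi w * g w) ->
  Ex P (fun w => xi w * g w) = Ex P xi * Ex P g.
Proof.
move=> sG Gm sH Hm GH Gxi Hg ixi ig ixig.
rewrite [RHS]mulrC; apply: (Ex_projection sG Gm ig) => // A GA.
have mA := Gm _ GA.
rewrite (Ex_eq P (g := fun w => g w * \1_A w)); last by move=> w; rewrite mulrC.
rewrite (@Ex_projection _ _ _ P H sH Hm (\1_A) (fine (P A)))//.
- by rewrite mulrC.
- by apply: integrable_indic.
- move=> C HC; have mC := Hm _ HC.
  rewrite (Ex_eq P (g := \1_(A `&` C))); last first.
    by move=> w; rewrite indicI mulrC.
  rewrite Ex_indic; last exact: measurableI.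
  by rewrite GH// fineM// ?fin_num_measure.
- under eq_fun do rewrite mulrC.
  apply: (intg_le _ (intg_norm ig)).
    by apply: measurable_funM; [exact: measurable_indic|exact: Gmeas_measurable Hg].
  by move=> w; rewrite normrM ler_piMl// indicE; case: (_ \in _);
    rewrite ?normr1 ?normr0.
Qed.

Lemma sigma_rv_algebra (X : T -> R) : sigma_algebra setT (sigma_rv X).
Proof. by apply: sigma_algebra_preimage; exact: sigma_algebra_measurable. Qed.

Lemma sigma_rv_measurable (X : T -> R) : measurable_fun setT X ->
  sigma_rv X `<=` measurable.
Proof. by move=> mX _ [U mU <-]; exact: mX. Qed.

Lemma Gmeas_sigma_rv (X : T -> R) (f : R -> R) : measurable_fun setT f ->
  Gmeas (sigma_rv X) (f \o X).
Proof.
move=> mf U mU; exists (f @^-1` U); last by rewrite setTI.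
by rewrite -[X in measurable X]setTI; exact: mf.
Qed.

End independence.

(** * Moments of Brownian increments given the past *)

Section brownian_increments.
Context d (T : measurableType d) (R : realType) (P : probability T R).
Context (F : R -> set_system T) (Ffilt : filtration F).
Implicit Types (B Z : R -> T -> R).

Lemma filtration_algebra t : 0 <= t -> sigma_algebra setT (F t).
Proof. by case: Ffilt => + _ _; apply. Qed.

Lemma filtration_measurable t : 0 <= t -> F t `<=` measurable.
Proof. by case: Ffilt => _ + _; apply. Qed.

Lemma filtration_le s t A : 0 <= s -> s <= t -> F s A -> F t A.
Proof. by case: Ffilt => _ _ le_F s0 st; exact: le_F. Qed.

Lemma adapted_le B s t : adapted F B -> 0 <= s -> s <= t -> Gmeas (F t) (B s).
Proof. by move=> aB s0 st U mU; apply: (filtration_le s0 st); exact: aB. Qed.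

Lemma adapted_measurable B t : adapted F B -> 0 <= t -> measurable_fun setT (B t).
Proof.
move=> aB t0; apply: (Gmeas_measurable (filtration_measurable t0)).
exact: adapted_le.
Qed.

Lemma Gmeas_increment B s t u : adapted F B -> 0 <= s -> s <= u -> 0 <= t ->
  t <= u -> Gmeas (F u) (fun w => B t w - B s w).
Proof.
move=> aB s0 su t0 tu; apply: GmeasB; first exact: (filtration_algebra (le_trans s0 su)).
  exact: adapted_le.
exact: adapted_le.
Qed.

(* The part of Levy's characterization that is stable under linear
   combinations of orthogonal processes; [v] is the variance of an increment *)
Definition levy_martingale (v : R -> R) (K : R) Z : Prop :=
  adapted F Z /\ forall s t, 0 <= s -> s < t ->
  [/\ L4 P (fun w => Z t w - Z s w),
      Ex P (fun w => (Z t w - Z s w) ^+ 4) <= K * (t - s) ^+ 2,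
      forall A, F s A -> Ex P (fun w => \1_A w * (Z t w - Z s w)) = 0
    & forall A, F s A -> Ex P (fun w => \1_A w * (Z t w - Z s w) ^+ 2) =
        v (t - s) * fine (P A)].

Lemma Ex_indic_indep s (X : T -> R) (f : R -> R) A : 0 <= s ->
  measurable_fun setT X -> measurable_fun setT f ->
  independent_systems P (F s) (sigma_rv X) -> intg P (f \o X) -> F s A ->
  Ex P (fun w => \1_A w * f (X w)) = fine (P A) * Ex P (f \o X).
Proof.
move=> s0 mX mf ind iX FA.
have mA := filtration_measurable s0 FA.
rewrite (Ex_indep (filtration_algebra s0) (filtration_measurable s0)
  (sigma_rv_algebra X) (sigma_rv_measurable mX) ind (g := f \o X)) ?Ex_indic//.
- exact: (@Gmeas_indic _ R _ (filtration_algebra s0) _ FA).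
- exact: Gmeas_sigma_rv.
- exact: integrable_indic.
- apply: (intg_le _ (intg_norm iX)).
    by apply: measurable_funM; [exact: measurable_indic|exact: intg_measurable iX].
  by move=> w; rewrite normrM ler_piMl// indicE; case: (_ \in _);
    rewrite ?normr1 ?normr0.
Qed.

Lemma brownian_normal_law B s t : brownian_motion P F B -> 0 <= s -> s < t ->
  normal_law P (fun w => B t w - B s w) (t - s).
Proof.
move=> [aB _ inc] s0 st; split.
  by apply: measurable_funB; apply: adapted_measurable => //; rewrite ltW// (le_lt_trans s0).
by move=> U mU; have [_] := inc s t s0 st; exact.
Qed.

Lemma brownian_levy_martingale B : brownian_motion P F B ->
  levy_martingale (@variance_normal R) 128 B.
Proof.
move=> Bbm; have [aB _ inc] := Bbm; split => // s t s0 st.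
have st0 : 0 < t - s by rewrite subr_gt0.
have nl := brownian_normal_law Bbm s0 st.
have [ind _] := inc s t s0 st.
have [i4 e4] := normal_law_moment4 st0 nl.
have LX : L4 P (fun w => B t w - B s w) by split => //; case: nl.
split => // A FA.
  rewrite (Ex_indic_indep s0 (f := id) _ _ ind)//; first last.
  - exact: L4_intg.
  - exact: LX.1.
  by rewrite (normal_law_Ex1 st0 nl) mulr0.
rewrite (Ex_indic_indep s0 (f := fun x => x ^+ 2) _ _ ind)//; first last.
- by under eq_fun do rewrite /= expr2; exact: L4_prod2.
- exact: LX.1.
by rewrite (normal_law_Ex2 st0 nl) mulrC.
Qed.

Lemma levy_martingale_Ex1 v K Z s t (xi : T -> R) : levy_martingale v K Z ->
  0 <= s -> s < t -> Gmeas (F s) xi -> L4 P xi ->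
  Ex P (fun w => xi w * (Z t w - Z s w)) = 0.
Proof.
move=> [aZ /(_ _ t)hZ] s0 st Gxi Lxi; have [LZ _ e1 _] := hZ s s0 st.
rewrite (@Ex_projection _ _ _ P _ (filtration_algebra s0)
  (filtration_measurable s0) _ 0) ?mul0r//.
- exact: L4_intg.
- by move=> A FA; rewrite mul0r e1.
- exact: L4_intg.
- exact: L4_prod2.
Qed.

Lemma levy_martingale_Ex2 v K Z s t (xi : T -> R) : levy_martingale v K Z ->
  0 <= s -> s < t -> Gmeas (F s) xi -> L4 P xi ->
  Ex P (fun w => xi w * (Z t w - Z s w) ^+ 2) = v (t - s) * Ex P xi.
Proof.
move=> [aZ /(_ _ t)hZ] s0 st Gxi Lxi; have [LZ _ _ e2] := hZ s s0 st.
rewrite (@Ex_projection _ _ _ P _ (filtration_algebra s0)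
  (filtration_measurable s0) _ (v (t - s)))//.
- by under eq_fun do rewrite expr2; exact: L4_prod2.
- exact: L4_intg.
- by under eq_fun do rewrite expr2 mulrA; exact: L4_prod3.
Qed.

Lemma sigma_process_algebra B : sigma_algebra setT (sigma_process B).
Proof. exact: smallest_sigma_algebra. Qed.

Lemma sigma_process_measurable B : adapted F B -> sigma_process B `<=` measurable.
Proof.
move=> aB; apply: smallest_sub.
  exact: sigma_algebra_measurable.
move=> A [t]; rewrite /= in_itv/= andbT => t0.
exact/sigma_rv_measurable/adapted_measurable.
Qed.

Lemma Gmeas_sigma_process B t : 0 <= t -> Gmeas (sigma_process B) (B t).
Proof.
move=> t0 U mU; apply: sub_sigma_algebra; exists t.
  by rewrite /= in_itv/= andbT.
by exists U => //; rewrite setTI.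
Qed.

End brownian_increments.

(** * Partitions into equal steps *)

Section regular_grid.
Context (R : realType).

Definition grid (s h : R) (j : nat) : R := s + j%:R * h.

Lemma grid0 s h : grid s h 0 = s.
Proof. by rewrite /grid mul0r addr0. Qed.

Lemma gridS s h j : grid s h j.+1 = grid s h j + h.
Proof. by rewrite /grid -natr1; ring. Qed.

Lemma grid_end s t n : (0 < n)%N -> grid s ((t - s) / n%:R) n = t.
Proof.
by move=> n0; rewrite /grid mulrC divfK ?subrKC// pnatr_eq0 -lt0n.
Qed.

Lemma grid_mono s h i j : 0 <= h -> (i <= j)%N -> grid s h i <= grid s h j.
Proof. by move=> h0 ij; rewrite lerD2l ler_wpM2r// ler_nat. Qed.

Lemma grid_ge s h j : 0 <= h -> s <= grid s h j.
Proof. by move=> h0; rewrite lerDl mulr_ge0. Qed.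

End regular_grid.

(** * The cross variation of the two Brownian motions *)

Section cross_variation.
Context d (T : measurableType d) (R : realType) (P : probability T R).
Context (F : R -> set_system T) (Ffilt : filtration F) (BX BY : R -> T -> R).
Hypotheses (BX_bm : brownian_motion P F BX) (BY_bm : brownian_motion P F BY).
Hypothesis BXY_indep : independent_processes P BX BY.

Let V := @variance_normal R.
Let MX := brownian_levy_martingale Ffilt BX_bm.
Let MY := brownian_levy_martingale Ffilt BY_bm.
Let aX : adapted F BX. Proof. by case: BX_bm. Qed.
Let aY : adapted F BY. Proof. by case: BY_bm. Qed.

Let LX s t : 0 <= s -> s < t -> L4 P (fun w => BX t w - BX s w).
Proof. by move=> s0 st; have [_ /(_ _ _ s0 st)[]] := MX. Qed.

Let LY s t : 0 <= s -> s < t -> L4 P (fun w => BY t w - BY s w).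
Proof. by move=> s0 st; have [_ /(_ _ _ s0 st)[]] := MY. Qed.

Section one_grid.
Variables (s h : R) (s0 : 0 <= s) (h0 : 0 < h).
Let u := grid s h.
Let dX j w := BX (u j.+1) w - BX (u j) w.
Let dY j w := BY (u j.+1) w - BY (u j) w.
Let S j w := \sum_(l < j) (dX l w * dY l w).

Let u0 j : 0 <= u j. Proof. by rewrite (le_trans s0)// grid_ge// ltW. Qed.
Let uS j : u j < u j.+1. Proof. by rewrite /u gridS ltrDl. Qed.
Let uSB j : u j.+1 - u j = h. Proof. by rewrite /u gridS; ring. Qed.
Let LdX j : L4 P (dX j). Proof. exact: LX. Qed.
Let LdY j : L4 P (dY j). Proof. exact: LY. Qed.

Let Ex_indepXY xi g : Gmeas (sigma_process BX) xi -> Gmeas (sigma_process BY) g ->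
  intg P xi -> intg P g -> intg P (fun w => xi w * g w) ->
  Ex P (fun w => xi w * g w) = Ex P xi * Ex P g.
Proof.
apply: Ex_indep BXY_indep.
- exact: sigma_process_algebra.
- exact: (sigma_process_measurable Ffilt).
- exact: sigma_process_algebra.
- exact: (sigma_process_measurable Ffilt).
Qed.

Let GdX j : Gmeas (sigma_process BX) (dX j).
Proof.
by apply: GmeasB; [exact: sigma_process_algebra|exact: Gmeas_sigma_process..].
Qed.

Let GdY j : Gmeas (sigma_process BY) (dY j).
Proof.
by apply: GmeasB; [exact: sigma_process_algebra|exact: Gmeas_sigma_process..].
Qed.

Let Ex_dYdY l j : (l < j)%N -> Ex P (fun w => dY l w * dY j w) = 0.
Proof.
move=> lj; apply: (levy_martingale_Ex1 Ffilt MY) => //.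
apply: (Gmeas_increment Ffilt) => //; apply: grid_mono; rewrite ?(ltW h0)//; exact: ltnW.
Qed.

(** Regrouped by process, the product factors by independence, and the factor dY_l dY_j has mean
    zero by the martingale property. *)
Let Ex_cross l j : (l < j)%N ->
  intg P (fun w => (dX l w * dY l w) * (dX j w * dY j w)) /\
  Ex P (fun w => (dX l w * dY l w) * (dX j w * dY j w)) = 0.
Proof.
move=> lj.
have E w : (dX l w * dY l w) * (dX j w * dY j w) =
  (dX l w * dX j w) * (dY l w * dY j w) by ring.
have I : intg P (fun w => (dX l w * dX j w) * (dY l w * dY j w)).
  by under eq_fun do rewrite mulrA; exact: L4_prod4.
under eq_fun do rewrite E; split => //.
rewrite Ex_indepXY ?Ex_dYdY ?mulr0//.
- by apply: GmeasM => //; exact: sigma_process_algebra.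
- by apply: GmeasM => //; exact: sigma_process_algebra.
- exact: L4_prod2.
- exact: L4_prod2.
Qed.

Let Ex_SD m j : (m <= j)%N -> intg P (fun w => S m w * (dX j w * dY j w)) /\
  Ex P (fun w => S m w * (dX j w * dY j w)) = 0.
Proof.
elim: m => [_|m IHm mj].
  rewrite /S; under eq_fun do rewrite big_ord0 mul0r.
  by rewrite Ex_cst; split => //; exact: intg_cst.
have [IS ES] := IHm (ltnW mj); have [Ic Ec] := Ex_cross mj.
have E w : S m.+1 w * (dX j w * dY j w) = S m w * (dX j w * dY j w) +
   (dX m w * dY m w) * (dX j w * dY j w) by rewrite /S big_ord_recr/= mulrDl.
rewrite (Ex_eq P E) ExD// ES Ec addr0; split => //.
by under eq_fun do rewrite E; exact: intgD.
Qed.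

Let Ex_D2 j : intg P (fun w => (dX j w * dY j w) ^+ 2) /\
  Ex P (fun w => (dX j w * dY j w) ^+ 2) = V h ^+ 2.
Proof.
have E w : (dX j w * dY j w) ^+ 2 = dX j w ^+ 2 * dY j w ^+ 2 by rewrite exprMn.
have I : intg P (fun w => dX j w ^+ 2 * dY j w ^+ 2).
  by under eq_fun do rewrite !expr2 mulrA; exact: L4_prod4.
have IX : intg P (fun w => dX j w ^+ 2).
  by under eq_fun do rewrite expr2; exact: L4_prod2.
have IY : intg P (fun w => dY j w ^+ 2).
  by under eq_fun do rewrite expr2; exact: L4_prod2.
have hh : 0 < u j.+1 - u j by rewrite uSB.
split; first by under eq_fun do rewrite E.
rewrite (Ex_eq P E) Ex_indepXY//.
- rewrite (normal_law_Ex2 hh (brownian_normal_law Ffilt BX_bm (u0 j) (uS j))).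
  rewrite (normal_law_Ex2 hh (brownian_normal_law Ffilt BY_bm (u0 j) (uS j))).
  by rewrite uSB expr2.
- by apply: (Gmeas_comp (sigma_process_algebra BX) (h := fun x => x ^+ 2) _ (GdX j)).
- by apply: (Gmeas_comp (sigma_process_algebra BY) (h := fun x => x ^+ 2) _ (GdY j)).
Qed.

Let Ex_S2 j : intg P (fun w => S j w ^+ 2) /\
  Ex P (fun w => S j w ^+ 2) = j%:R * V h ^+ 2.
Proof.
elim: j => [|j [Ij Ej]].
  rewrite /S; under eq_fun do rewrite big_ord0 expr0n.
  by rewrite Ex_cst mul0r; split => //; exact: intg_cst.
have [IS ES] := Ex_SD (leqnn j); have [ID ED] := Ex_D2 j.
have E w : S j.+1 w ^+ 2 = S j w ^+ 2 + 2 * (S j w * (dX j w * dY j w)) +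
   (dX j w * dY j w) ^+ 2 by rewrite /S big_ord_recr/=; ring.
have I2 := intgZ 2 IS; have I3 := intgD Ij I2.
split; first by under eq_fun do rewrite E; exact: intgD.
by rewrite (Ex_eq P E) ExD// ExD// ExZ// Ej ES ED -natr1; ring.
Qed.

Let mS j : measurable_fun setT (S j).
Proof.
rewrite /S; apply: measurable_sum => l.
by apply: measurable_funM; [case: (LdX l)|case: (LdY l)].
Qed.

Let intg_indicS A j : measurable A -> intg P (fun w => \1_A w * S j w).
Proof.
move=> mA; have [IS _] := Ex_S2 j.
apply: (intg_le _ (intgD (intg_cst P 1) IS)).
  exact: measurable_funM (measurable_indic mA) (mS j).
move=> w; have : `|S j w| <= 1 + S j w ^+ 2.
  by rewrite ler_norml; have := sqr_ge0 (S j w - 1);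
    have := sqr_ge0 (S j w + 1); have := sqr_ge0 (S j w); lra.
apply: le_trans; rewrite normrM ler_piMl// indicE.
by case: (_ \in _); rewrite ?normr1 ?normr0.
Qed.

(** Discrete integration by parts: an increment of one process since time s, times the next
    increment of the other, has mean zero on A by the martingale property for F. Only the products
    of simultaneous increments survive. *)
Let Ex_XY A j : F s A ->
  Ex P (fun w => \1_A w * ((BX (u j) w - BX s w) * (BY (u j) w - BY s w))) =
  Ex P (fun w => \1_A w * S j w).
Proof.
move=> FA; have mA := filtration_measurable Ffilt s0 FA.
have sle i : s <= u i by rewrite grid_ge// ltW.
have FAj i : F (u i) A by exact: filtration_le FA.
have Lu (B : R -> T -> R) i :
    (forall s t, 0 <= s -> s < t -> L4 P (fun w => B t w - B s w)) ->
    L4 P (fun w => B (u i) w - B s w).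
  move=> LB; have := sle i; rewrite le_eqVlt => /predU1P[<-|]; last exact: LB.
  under eq_fun do rewrite subrr; exact: L4_cst.
have LXu i := Lu BX i LX; have LYu i := Lu BY i LY.
have L1 := L4_indic P mA.
elim: j => [|j IHj].
  apply: Ex_eq => w; rewrite /u grid0 /S big_ord0; ring.
have E w : \1_A w * ((BX (u j.+1) w - BX s w) * (BY (u j.+1) w - BY s w)) =
    \1_A w * ((BX (u j) w - BX s w) * (BY (u j) w - BY s w)) +
    (\1_A w * (BX (u j) w - BX s w)) * dY j w +
    (\1_A w * (BY (u j) w - BY s w)) * dX j w + \1_A w * (dX j w * dY j w).
  by rewrite /dX /dY; ring.
have E' w : \1_A w * S j.+1 w = \1_A w * S j w + \1_A w * (dX j w * dY j w).
  by rewrite /S big_ord_recr/= mulrDr.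
have I1 : intg P (fun w => \1_A w * ((BX (u j) w - BX s w) * (BY (u j) w - BY s w))).
  by under eq_fun do rewrite mulrA; exact: L4_prod3.
have I2 : intg P (fun w => (\1_A w * (BX (u j) w - BX s w)) * dY j w).
  exact: L4_prod3.
have I3 : intg P (fun w => (\1_A w * (BY (u j) w - BY s w)) * dX j w).
  exact: L4_prod3.
have I4 : intg P (fun w => \1_A w * (dX j w * dY j w)).
  by under eq_fun do rewrite mulrA; exact: L4_prod3.
have I5 := intg_indicS j mA.
have GA : Gmeas (F (u j)) (\1_A : T -> R).
  exact: (@Gmeas_indic _ R _ (filtration_algebra Ffilt (u0 j)) _ (FAj j)).
rewrite (Ex_eq P E) (Ex_eq P E') ExD//; last by do 2 apply: intgD => //.
rewrite ExD//; last exact: intgD.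
rewrite ExD// [RHS]ExD// -IHj.
rewrite (levy_martingale_Ex1 Ffilt MY)//; last 2 first.
- apply: GmeasM => //; first exact: (filtration_algebra Ffilt (u0 j)).
  by apply: (Gmeas_increment Ffilt).
- exact: L4_indicM.
rewrite (levy_martingale_Ex1 Ffilt MX)//; last 2 first.
- apply: GmeasM => //; first exact: (filtration_algebra Ffilt (u0 j)).
  by apply: (Gmeas_increment Ffilt).
- exact: L4_indicM.
by rewrite !addr0.
Qed.

Lemma cross_variation_le A j : F s A ->
  (Ex P (fun w => \1_A w * ((BX (u j) w - BX s w) * (BY (u j) w - BY s w)))) ^+ 2 <=
  j%:R * V h ^+ 2.
Proof.
move=> FA; rewrite Ex_XY//; have [IS ES] := Ex_S2 j.
have mA := filtration_measurable Ffilt s0 FA.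
set x := Ex P _.
have I1 := intg_indicS j mA.
(* Cauchy-Schwarz: 0 <= E (1_A S - x)^2 and (1_A S)^2 <= S^2 *)
have I2 := intgZ (- (2 * x)) I1; have I3 := intg_cst P (x ^+ 2).
have : 0 <= Ex P (fun w => S j w ^+ 2 + - (2 * x) * (\1_A w * S j w) + x ^+ 2).
  apply: Ex_ge0 => w.
  have : (\1_A w * S j w) ^+ 2 <= S j w ^+ 2.
    by rewrite exprMn ler_piMl ?sqr_ge0.
  have := sqr_ge0 (\1_A w * S j w - x); lra.
rewrite ExD//; last exact: intgD.
rewrite ExD// ExZ// Ex_cst ES -/x; lra.
Qed.

End one_grid.

Lemma cross_variation0 s t A : 0 <= s -> s < t -> F s A ->
  Ex P (fun w => \1_A w * ((BX t w - BX s w) * (BY t w - BY s w))) = 0.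
Proof.
move=> s0 st FA; set x := Ex P _; apply/eqP; rewrite -sqrf_eq0 eq_le sqr_ge0 andbT.
(* With h = (t - s) / n and V h <= 129 h, the bound n V(h) ^ 2 is at most C / n. *)
pose C := (129 * (t - s)) ^+ 2.
have C0 : 0 <= C by exact: sqr_ge0.
suff le_n n : x ^+ 2 <= C / n.+1%:R.
  apply/ler_addgt0Pr => e e0; rewrite add0r.
  pose n := Num.truncn (C / e).
  apply: (le_trans (le_n n)); rewrite ler_pdivrMr ?ltr0n//.
  rewrite mulrC -ler_pdivrMr//.
  by rewrite ltW// truncnS_gt.
have n0 : 0 < n.+1%:R :> R by rewrite ltr0n.
pose h := (t - s) / n.+1%:R.
have h0 : 0 < h by rewrite divr_gt0// subr_gt0.
have := cross_variation_le s0 h0 n.+1 FA.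
rewrite grid_end// -/x => /le_trans; apply.
have /andP[V0 Vh] := variance_normal_le h0.
have : V h ^+ 2 <= (129 * h) ^+ 2 by rewrite lerXn2r// nnegrE// mulr_ge0// ltW.
rewrite -(ler_pM2l n0) => /le_trans; apply.
rewrite le_eqVlt; apply/orP; left; apply/eqP; rewrite /C /h; field.
by rewrite gt_eqF.
Qed.

(** The mixed term of the square vanishes by [cross_variation0]. The constant 1024 is 8 * 128, with
    8 coming from [quartic_add]. *)
Lemma combination_levy_martingale a b :
  levy_martingale P F (fun h => (a ^+ 2 + b ^+ 2) * V h)
    (1024 * (a ^+ 4 + b ^+ 4)) (fun t w => a * BX t w + b * BY t w).
Proof.
split.
  move=> t t0; have sF := filtration_algebra Ffilt t0.
  exact: (GmeasD sF (GmeasZ sF a (aX t0)) (GmeasZ sF b (aY t0))).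
move=> s t s0 st.
have [_ /(_ s t s0 st)[LXi X4 X1 X2]] := MX.
have [_ /(_ s t s0 st)[LYi Y4 Y1 Y2]] := MY.
have E w : a * BX t w + b * BY t w - (a * BX s w + b * BY s w) =
  a * (BX t w - BX s w) + b * (BY t w - BY s w) by ring.
have LZ : L4 P (fun w => a * BX t w + b * BY t w - (a * BX s w + b * BY s w)).
  by under eq_fun do rewrite E; apply: L4D; exact: L4Z.
split => //.
- have I1 := intgZ (8 * a ^+ 4) LXi.2; have I2 := intgZ (8 * b ^+ 4) LYi.2.
  apply: (@le_trans _ _ (Ex P (fun w => 8 * a ^+ 4 * (BX t w - BX s w) ^+ 4 +
      8 * b ^+ 4 * (BY t w - BY s w) ^+ 4))).
    apply: Ex_le; [exact: LZ.2|exact: intgD|move=> w].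
    by rewrite E (le_trans (quartic_add _ _))// !exprMn !mulrA.
  rewrite ExD// (ExZ _ LXi.2) (ExZ _ LYi.2); set h := (t - s) ^+ 2.
  have a4 : 0 <= a ^+ 4 by rewrite exprn_even_ge0.
  have b4 : 0 <= b ^+ 4 by rewrite exprn_even_ge0.
  have := ler_wpM2l a4 X4; have := ler_wpM2l b4 Y4; rewrite -/h; lra.
- move=> A FA; have mA := filtration_measurable Ffilt s0 FA.
  have J1 := L4_prod2 (L4_indic P mA) LXi.
  have J2 := L4_prod2 (L4_indic P mA) LYi.
  have I1 := intgZ a J1; have I2 := intgZ b J2.
  rewrite (Ex_eq P (g := fun w => a * (\1_A w * (BX t w - BX s w)) +
      b * (\1_A w * (BY t w - BY s w)))); last by move=> w; rewrite E; ring.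
  rewrite ExD// (ExZ _ J1) (ExZ _ J2).
  by rewrite X1// Y1// !mulr0 addr0.
- move=> A FA; have mA := filtration_measurable Ffilt s0 FA.
  have L1 := L4_indic P mA.
  have I1 : intg P (fun w => \1_A w * (BX t w - BX s w) ^+ 2).
    by under eq_fun do rewrite expr2 mulrA; exact: L4_prod3.
  have I2 : intg P (fun w => \1_A w * (BY t w - BY s w) ^+ 2).
    by under eq_fun do rewrite expr2 mulrA; exact: L4_prod3.
  have I3 : intg P (fun w => \1_A w * ((BX t w - BX s w) * (BY t w - BY s w))).
    by under eq_fun do rewrite mulrA; exact: L4_prod3.
  have J1 := intgZ (a ^+ 2) I1; have J2 := intgZ (b ^+ 2) I2.
  have J3 := intgZ (2 * a * b) I3; have J4 := intgD J1 J2.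
  rewrite (Ex_eq P (g := fun w => a ^+ 2 * (\1_A w * (BX t w - BX s w) ^+ 2) +
      b ^+ 2 * (\1_A w * (BY t w - BY s w) ^+ 2) +
      2 * a * b * (\1_A w * ((BX t w - BX s w) * (BY t w - BY s w)))));
    last by move=> w; rewrite E; ring.
  rewrite ExD// ExD// (ExZ _ I1) (ExZ _ I2) (ExZ _ I3) X2// Y2// cross_variation0// /V; ring.
Qed.

End cross_variation.

(** * The conditional law of the increments of a pair *)

Section levy_characterization.
Context d (T : measurableType d) (R : realType) (P : probability T R).
Context (F : R -> set_system T) (Ffilt : filtration F).

Lemma measurable_cos : measurable_fun [set: R] (@cos R).
Proof. by apply: continuous_measurable_fun; exact: continuous_cos. Qed.

Lemma measurable_sin : measurable_fun [set: R] (@sin R).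
Proof. by apply: continuous_measurable_fun; exact: continuous_sin. Qed.

Lemma norm_cos_le1 (x : R) : `|cos x| <= 1.
Proof. by rewrite ler_norml cos_geN1 cos_le1. Qed.

Lemma norm_sin_le1 (x : R) : `|sin x| <= 1.
Proof. by rewrite ler_norml sin_geN1 sin_le1. Qed.

Lemma norm_indicM_le (A : set T) (w : T) (x K : R) :
  `|x| <= K -> `|\1_A w * x| <= K.
Proof.
move=> xK; rewrite normrM (le_trans _ xK)// ler_piMl// indicE.
by case: (_ \in _); rewrite ?normr1 ?normr0.
Qed.

Section one_process.
Variables (v : R -> R) (K C : R) (Z : R -> T -> R).
Hypothesis MZ : levy_martingale P F v K Z.
Hypothesis v_le : forall h, 0 < h -> 0 <= v h <= C * h.

Let aZ : adapted F Z. Proof. by case: MZ. Qed.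

(** In the expansion of the cosine around [W], the first order term has mean zero given F_s, and the
    second order one turns the squared increment into its variance v. [W] collects the increments
    already made and the phase. *)
Lemma levy_cos_step s t (W : T -> R) A (k : R) : 0 <= s -> s < t -> 1 <= k ->
  Gmeas (F s) W -> F s A ->
  `|Ex P (fun w => \1_A w * cos (W w + (Z t w - Z s w))) -
    (1 - v (t - s) / 2) * Ex P (fun w => \1_A w * cos (W w))| <=
  C * (t - s) / k + k * (K * (t - s) ^+ 2).
Proof.
move=> s0 st k1 GW FA; have k0 : 0 < k by lra.
have [_ /(_ s t s0 st)[LZ Z4 _ _]] := MZ.
have mA := filtration_measurable Ffilt s0 FA.
have sF := filtration_algebra Ffilt s0.
have mW := Gmeas_measurable (filtration_measurable Ffilt s0) GW.
have GA := @Gmeas_indic _ R _ sF _ FA.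
have Gc : Gmeas (F s) (fun w => \1_A w * cos (W w)).
  by apply: (GmeasM sF GA); apply: (Gmeas_comp sF measurable_cos GW).
have Gs : Gmeas (F s) (fun w => \1_A w * sin (W w)).
  by apply: (GmeasM sF GA); apply: (Gmeas_comp sF measurable_sin GW).
have Lc : L4 P (fun w => \1_A w * cos (W w)).
  apply: (@L4_bounded _ _ _ _ _ 1).
    exact: (Gmeas_measurable (filtration_measurable Ffilt s0) Gc).
  by move=> w; apply: norm_indicM_le; exact: norm_cos_le1.
have Ls : L4 P (fun w => \1_A w * sin (W w)).
  apply: (@L4_bounded _ _ _ _ _ 1).
    exact: (Gmeas_measurable (filtration_measurable Ffilt s0) Gs).
  by move=> w; apply: norm_indicM_le; exact: norm_sin_le1.
pose D w := Z t w - Z s w.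
have mD : measurable_fun setT D by exact: LZ.1.
have ID2 : intg P (fun w => D w ^+ 2).
  by under eq_fun do rewrite expr2; exact: L4_prod2.
have ED2 : Ex P (fun w => D w ^+ 2) = v (t - s).
  have := levy_martingale_Ex2 Ffilt MZ s0 st (Gmeas_cst sF 1) (L4_cst P 1).
  by rewrite Ex_cst mulr1; under eq_fun do rewrite mul1r.
have IcD : intg P (fun w => \1_A w * cos (W w + D w)).
  apply: (@intg_bounded _ _ _ _ _ 1).
    apply: measurable_funM; first exact: measurable_indic.
    apply: (measurableT_comp measurable_cos); exact: measurable_funD.
  by move=> w; apply: norm_indicM_le; exact: norm_cos_le1.
have IsD : intg P (fun w => \1_A w * sin (W w) * D w) by exact: L4_prod2.
have IcD2 : intg P (fun w => \1_A w * cos (W w) * D w ^+ 2).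
  by under eq_fun do rewrite expr2 mulrA; exact: L4_prod3.
have J2 := intgZ 2^-1 IcD2.
pose f w := \1_A w * (cos (W w + D w) - cos (W w) + D w * sin (W w) +
   D w ^+ 2 / 2 * cos (W w)).
have fE w : f w = \1_A w * cos (W w + D w) - \1_A w * cos (W w) +
    \1_A w * sin (W w) * D w + 2^-1 * (\1_A w * cos (W w) * D w ^+ 2).
  by rewrite /f; ring.
have Ic := L4_intg Lc.
have I1 := intgB IcD Ic; have I2 := intgD I1 IsD; have I3 := intgD I2 J2.
have -> : Ex P (fun w => \1_A w * cos (W w + (Z t w - Z s w))) -
    (1 - v (t - s) / 2) * Ex P (fun w => \1_A w * cos (W w)) = Ex P f.
  rewrite (Ex_eq P fE) (ExD I2 J2) (ExD I1 IsD) (ExB IcD Ic) (ExZ _ IcD2).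
  rewrite (levy_martingale_Ex1 Ffilt MZ s0 st Gs Ls).
  rewrite (levy_martingale_Ex2 Ffilt MZ s0 st Gc Lc); ring.
have K1 := intgZ k^-1 ID2; have K2 := intgZ k LZ.2; have K3 := intgD K1 K2.
apply: (le_trans (Ex_norm_le _ K3 _)).
- by rewrite (funext fE); exact: intg_measurable I3.
- move=> w; apply: norm_indicM_le.
  by have := cos_taylor (W w) (D w) k1; rewrite (mulrC _ k^-1).
rewrite (ExD K1 K2) (ExZ _ ID2) (ExZ _ LZ.2) ED2 mulrC.
apply: lerD; last by rewrite ler_pM2l.
rewrite ler_pM2r ?invr_gt0//.
have st0 : 0 < t - s by rewrite subr_gt0.
by have /andP[] := v_le st0.
Qed.

(** The errors of the single steps merely add up, because v h <= 4 keeps the factor 1 - v h / 2 in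
    [-1, 1]. *)
Lemma levy_cos_grid s h A c (k : R) n : 0 <= s -> 0 < h -> 1 <= k ->
  v h <= 4 -> F s A ->
  `|Ex P (fun w => \1_A w * cos (Z (grid s h n) w - Z s w + c)) -
    (1 - v h / 2) ^+ n * (fine (P A) * cos c)| <=
  n%:R * (C * h / k + k * (K * h ^+ 2)).
Proof.
move=> s0 h0 k1 v4 FA; set e := C * h / k + _.
have mA := filtration_measurable Ffilt s0 FA.
elim: n => [|n IHn].
  rewrite grid0 (Ex_eq P (g := fun w => cos c * \1_A w)); last first.
    by move=> w; rewrite subrr add0r mulrC.
  rewrite ExZ; last exact: integrable_indic.
  by rewrite Ex_indic// expr0 !mul1r mul0r (mulrC (fine _)) subrr normr0.
set u := grid s h n.
have su : s <= u by rewrite grid_ge// ltW.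
have u0 : 0 <= u by exact: le_trans su.
have uu : u < grid s h n.+1 by rewrite gridS ltrDl.
pose W w := Z u w - Z s w + c.
have GW : Gmeas (F u) W.
  apply: (GmeasD (filtration_algebra Ffilt u0)).
    exact: (Gmeas_increment Ffilt).
  exact: (Gmeas_cst (filtration_algebra Ffilt u0)).
have := levy_cos_step u0 uu k1 GW (filtration_le Ffilt s0 su FA).
rewrite gridS -/u (_ : u + h - u = h); last ring.
rewrite (Ex_eq P (g := fun w => \1_A w * cos (Z (u + h) w - Z s w + c))); last first.
  by move=> w; congr (_ * cos _); rewrite /W; ring.
rewrite -/e; set m' := Ex P _; set m := Ex P _ => step.
have r1 : `|1 - v h / 2| <= 1.
  by have /andP[v0 _] := v_le h0; rewrite ler_norml; lra.
have -> : m' - (1 - v h / 2) ^+ n.+1 * (fine (P A) * cos c) =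
  (m' - (1 - v h / 2) * m) +
  (1 - v h / 2) * (m - (1 - v h / 2) ^+ n * (fine (P A) * cos c)).
  by rewrite exprS; ring.
rewrite (_ : n.+1%:R * e = e + n%:R * e); last by rewrite -natr1; ring.
apply: (le_trans (ler_normD _ _)); rewrite lerD// normrM.
by rewrite (le_trans _ IHn)// ler_piMl.
Qed.

(** It depends on the process only through v, which is what makes two processes with the same
    variances comparable. *)
Definition levy_approx (h : R) (k : nat) : R :=
  (1 - v (h / (k.+1 ^ 2)%:R) / 2) ^+ (k.+1 ^ 2).

(* With k ^ 2 steps and weight k in cos_taylor, the accumulated error is O(1/k) *)
Lemma levy_cos_cvg s t A c : 0 <= s -> s < t -> F s A ->
  levy_approx (t - s) k * (fine (P A) * cos c) @[k --> \oo] -->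
  Ex P (fun w => \1_A w * cos (Z t w - Z s w + c)).
Proof.
move=> s0 st FA; set h := t - s; have h0 : 0 < h by rewrite subr_gt0.
have C0 : 0 <= C by have /andP[] := v_le ltr01; rewrite mulr1; exact: le_trans.
(* D / (k + 1) bounds both the accumulated error and the variance of a single step; the absolute
   value is there because the sign of K is unknown. *)
pose D := C * h + `|K| * h ^+ 2.
have D0 : 0 <= D by rewrite addr_ge0 ?mulr_ge0 ?exprn_ge0// ltW.
have D_cvg : D * (k.+1%:R)^-1 @[k --> \oo] --> 0.
  by rewrite -[X in _ --> X](mulr0 D); apply: cvgM; [exact: cvg_cst|exact: cvg_harmonic].
apply/cvgrPdist_le => e e0.
near=> k.
have near4 : D / k.+1%:R <= 4.
  have : `|0 - D * k.+1%:R^-1| <= 4 by near: k; have /cvgrPdist_le := D_cvg; apply.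
  by rewrite sub0r normrN ger0_norm// divr_ge0.
have neare : D / k.+1%:R <= e.
  have : `|0 - D * k.+1%:R^-1| <= e by near: k; have /cvgrPdist_le := D_cvg; apply.
  by rewrite sub0r normrN ger0_norm// divr_ge0.
have k1 : 1 <= k.+1%:R :> R by rewrite ler1n.
have kp : 0 < k.+1%:R :> R by rewrite ltr0n.
have n0 : (0 < k.+1 ^ 2)%N by rewrite expn_gt0.
pose g := h / (k.+1 ^ 2)%:R.
have g0 : 0 < g by rewrite divr_gt0// ltr0n.
have v4 : v g <= 4.
  have /andP[_ /le_trans] := v_le g0; apply; apply: le_trans near4.
  rewrite /g natrX mulrA ler_pdivrMr ?exprn_gt0// expr2 mulrA divfK ?gt_eqF//.
  rewrite -[leLHS]mulr1 ler_pM//; first by rewrite mulr_ge0// ltW.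
  by rewrite lerDl mulr_ge0// exprn_ge0// ltW.
have := levy_cos_grid c (k.+1 ^ 2) s0 g0 k1 v4 FA.
rewrite grid_end// => /le_trans; apply; apply: le_trans neare.
rewrite (_ : _ * _ = (C * h + K * h ^+ 2) / k.+1%:R); last first.
  by rewrite /g natrX; field; rewrite gt_eqF.
rewrite ler_pM2r ?invr_gt0// lerD2l ler_wpM2r ?ler_norm// exprn_ge0// ltW.
Unshelve. all: by end_near. Qed.

End one_process.

(* U and V have jointly normal independent increments, independent of the past:
   the trigonometric functions stand for the conditional characteristic
   function of the increments *)
Definition gaussian_pair (U V : R -> T -> R) : Prop :=
  [/\ adapted F U, adapted F V & forall s t A a b c, 0 <= s -> s < t -> F s A ->
    Ex P (fun w => \1_A w * cos (a * (U t w - U s w) + b * (V t w - V s w) + c)) =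
    fine (P A) * cos c * cos_normal (t - s) (a ^+ 2 + b ^+ 2)].

(* a * BX + b * BY and sqrt (a ^ 2 + b ^ 2) * BX have increments of the same
   variance, so that levy_cos_cvg gives them the same limit; the latter process
   is normal *)
Lemma gaussian_pair_indep (BX BY : R -> T -> R) :
  brownian_motion P F BX -> brownian_motion P F BY ->
  independent_processes P BX BY -> gaussian_pair BX BY.
Proof.
move=> BX_bm BY_bm BXY_indep; split; [by case: BX_bm|by case: BY_bm|].
move=> s t A a b c s0 st FA.
pose q := a ^+ 2 + b ^+ 2; have q0 : 0 <= q by rewrite addr_ge0 ?sqr_ge0.
pose V := @variance_normal R.
have v_le h : 0 < h -> 0 <= q * V h <= 129 * q * h.
  move=> h0; have /andP[V0 Vh] := variance_normal_le h0.
  by rewrite mulr_ge0//= (mulrC 129) -mulrA ler_wpM2l.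
have M1 := combination_levy_martingale Ffilt BX_bm BY_bm BXY_indep a b.
have M2 : levy_martingale P F (fun h => q * V h) (1024 * (Num.sqrt q ^+ 4 + 0 ^+ 4))
    (fun t w => Num.sqrt q * BX t w + 0 * BY t w).
  have := combination_levy_martingale Ffilt BX_bm BY_bm BXY_indep (Num.sqrt q) 0.
  by rewrite sqr_sqrtr// expr0n addr0.
have c1 := levy_cos_cvg M1 v_le (c := c) s0 st FA.
(* At A = setT and c = 0, the normal comparison process identifies the limit of [levy_approx] as
   [cos_normal (t - s) q]. *)
have c2 := levy_cos_cvg M2 v_le (c := 0) s0 st (G_setT (filtration_algebra Ffilt s0)).
have st0 : 0 < t - s by rewrite subr_gt0.
have E2 : Ex P (fun w => \1_setT w * cos (Num.sqrt q * BX t w + 0 * BY t w -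
    (Num.sqrt q * BX s w + 0 * BY s w) + 0)) = cos_normal (t - s) q.
  rewrite -(normal_law_cos q (brownian_normal_law Ffilt BX_bm s0 st)).
  apply: Ex_eq => w; rewrite indicE in_setT mul1r; congr cos; ring.
move: c2; rewrite E2 probability_setT cos0 => c2.
have E1 : Ex P (fun w => \1_A w * cos (a * (BX t w - BX s w) +
    b * (BY t w - BY s w) + c)) =
  Ex P (fun w => \1_A w * cos (a * BX t w + b * BY t w -
    (a * BX s w + b * BY s w) + c)).
  by apply: Ex_eq => w; congr (_ * cos _); ring.
rewrite E1; apply: (cvg_unique (@Rhausdorff R) c1).
have -> : (fun k => levy_approx (fun h => (a ^+ 2 + b ^+ 2) * V h) (t - s) k *
    (fine (P A) * cos c)) =
  (fun k => (fine (P A) * cos c) *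
    (levy_approx (fun h => q * V h) (t - s) k * (fine 1 * 1))).
  by apply/funext => k; rewrite /= !mulr1 mulrC.
by apply: cvgM; [exact: cvg_cst|exact: c2].
Qed.

End levy_characterization.

(** * The sign function as a limit of polynomials in sines *)

Section sign_approximation.
Context (R : realType).
Implicit Types x y : R.

(* Iterating this odd polynomial on [-1, 1] converges to the sign function *)
Definition sgpoly y : R := (3 * y - y ^+ 3) / 2.

Lemma sgpolyN y : sgpoly (- y) = - sgpoly y.
Proof. by rewrite /sgpoly; field. Qed.

Lemma sgpoly_norm_le1 y : `|y| <= 1 -> `|sgpoly y| <= 1.
Proof.
rewrite !ler_norml /sgpoly => /andP[y1 y2].
have h1 : 0 <= (1 - y) ^+ 2 * (2 + y) by rewrite mulr_ge0 ?sqr_ge0//; lra.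
have h2 : 0 <= (1 + y) ^+ 2 * (2 - y) by rewrite mulr_ge0 ?sqr_ge0//; lra.
have : (1 - y) ^+ 2 * (2 + y) = 2 - 3 * y + y ^+ 3 by ring.
have : (1 + y) ^+ 2 * (2 - y) = 2 + 3 * y - y ^+ 3 by ring.
lra.
Qed.

Lemma iter_sgpoly_norm_le1 n y : `|y| <= 1 -> `|iter n sgpoly y| <= 1.
Proof. by move=> y1; elim: n => //= n IHn; exact: sgpoly_norm_le1. Qed.

(** For y > 0 the iterates z stay in [y, 1], and each step multiplies the distance to 1 by (1 - z)
    (2 + z) / 2 <= 1 - y / 2, so the convergence to 1 is geometric. Oddness covers y < 0. *)
Lemma iter_sgpoly_cvg y : `|y| <= 1 -> iter n sgpoly y @[n --> \oo] --> Num.sg y.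
Proof.
wlog y0 : y / 0 <= y => [hw y1|].
  have [/hw|/ltW yle0] := leP 0 y; first exact.
  have {hw} := hw (- y); rewrite oppr_ge0 normrN sgrN => /(_ yle0 y1) hw.
  have E n : iter n sgpoly y = - iter n sgpoly (- y).
    by elim: n => [|n IHn] /=; [rewrite opprK|rewrite IHn sgpolyN].
  rewrite -[X in _ --> X]opprK; under eq_cvg do rewrite E.
  exact: cvgN.
rewrite (ger0_norm y0) => y1.
move: y0; rewrite le_eqVlt => /predU1P[<-|y0].
  rewrite sgr0; under eq_cvg => n.
    rewrite (_ : iter n sgpoly 0 = 0); last first.
      by elim: n => //= n ->; rewrite /sgpoly; field.
    over.
  exact: cvg_cst.
rewrite gtr0_sg//.
have bnd n : y <= iter n sgpoly y <= 1 /\ 1 - iter n sgpoly y <= (1 - y / 2) ^+ n.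
  elim: n => [|n [/andP[yz z1] zn]]; first by rewrite /= expr0; split; lra.
  rewrite /= exprS; set z := iter n sgpoly y in yz z1 zn *.
  have q1 : 1 - sgpoly z = (1 - z) * ((1 - z) * (2 + z) / 2).
    by rewrite /sgpoly; field.
  have q2 : sgpoly z - z = z * (1 - z) * (1 + z) / 2 by rewrite /sgpoly; field.
  have a0 : 0 <= (1 - z) * (2 + z) / 2.
    by rewrite !mulr_ge0//; lra.
  have a1 : (1 - z) * (2 + z) / 2 <= 1 - y / 2.
    have := sqr_ge0 z; lra.
  have q20 : 0 <= z * (1 - z) * (1 + z) / 2 by rewrite !mulr_ge0//; lra.
  have z10 : 0 <= 1 - z by lra.
  have q10 : 0 <= (1 - z) * ((1 - z) * (2 + z) / 2) by exact: mulr_ge0.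
  split; first by apply/andP; split; lra.
  by rewrite q1 mulrC ler_pM.
have c0 : (1 - y / 2) ^+ n @[n --> \oo] --> (0 : R).
  by apply: cvg_expr; rewrite ger0_norm; lra.
have c1 : 1 - (1 - y / 2) ^+ n @[n --> \oo] --> (1 : R).
  by rewrite -[X in _ --> X]subr0; apply: cvgB => //; exact: cvg_cst.
apply: (@squeeze_cvgr _ _ _ _ (fun n => 1 - (1 - y / 2) ^+ n) (cst 1)) => //; last exact: cvg_cst.
by apply: nearW => n; have [/andP[_ z1] z2] := bnd n; apply/andP; split; rewrite /=; lra.
Qed.

(** For n large the argument lies in ]- pi, pi[, where the sine has the sign of its argument. This
    removes the periodicity. *)
Lemma sg_sin_cvg x c :
  Num.sg (sin ((x - c) / n.+1%:R)) @[n --> \oo] --> Num.sg (x - c).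
Proof.
move: (x - c) => {c}x.
wlog x0 : x / 0 <= x => [hw|].
  have [/hw//|/ltW xle0] := leP 0 x.
  have {hw} := hw (- x); rewrite oppr_ge0 sgrN => /(_ xle0) hw.
  rewrite -[X in _ --> X]opprK.
  under eq_cvg do rewrite -[x in _ (x / _)]opprK mulNr sinN sgrN.
  exact: cvgN.
move: x0; rewrite le_eqVlt => /predU1P[<-|x0].
  by under eq_cvg do rewrite mul0r sin0; exact: cvg_cst.
have xn : x * (n.+1%:R)^-1 @[n --> \oo] --> 0.
  by rewrite -[X in _ --> X](mulr0 x); apply: cvgM; [exact: cvg_cst|exact: cvg_harmonic].
apply: (@cvg_trans _ (cst (Num.sg x) @ \oo)); last exact: cvg_cst.
apply: near_eq_cvg; near=> n.
have xn0 : 0 < x / n.+1%:R by rewrite divr_gt0.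
rewrite /= (gtr0_sg x0) gtr0_sg// sin_gt0_pi// xn0/=.
have : `|0 - x / n.+1%:R| < pi.
  by near: n; have /cvgrPdist_lt := xn; apply; exact: pi_gt0.
by rewrite sub0r normrN gtr0_norm.
Unshelve. all: by end_near. Qed.

End sign_approximation.

(** * Trigonometric integrals determine a law on the real line *)

Section trigonometric_uniqueness.
Context (R : realType).

Definition bounded_measurable (f : R -> R) : Prop :=
  measurable_fun setT f /\ exists K, forall x, `|f x| <= K.

(** L stands for the difference of the integrals against two finite measures; only linearity and
    bounded convergence are retained. *)
Variable L : (R -> R) -> R.
Hypothesis LD : forall f g, bounded_measurable f -> bounded_measurable g ->
  L (fun x => f x + g x) = L f + L g.
Hypothesis LZ : forall k f, bounded_measurable f -> L (fun x => k * f x) = k * L f.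
Hypothesis Lcvg : forall (f_ : nat -> R -> R) (f : R -> R) (K : R),
  (forall n, measurable_fun setT (f_ n)) -> (forall n x, `|f_ n x| <= K) ->
  (forall x, f_ ^~ x @ \oo --> f x) -> L (f_ n) @[n --> \oo] --> L f.
Hypothesis Lcos : forall th c, L (fun x => cos (th * x + c)) = 0.

Let bmD f g : bounded_measurable f -> bounded_measurable g ->
  bounded_measurable (fun x => f x + g x).
Proof.
move=> [mf [K fK]] [mg [M gM]]; split; first exact: measurable_funD.
by exists (K + M) => x; rewrite (le_trans (ler_normD _ _))// lerD.
Qed.

Let bmM f g : bounded_measurable f -> bounded_measurable g ->
  bounded_measurable (fun x => f x * g x).
Proof.
move=> [mf [K fK]] [mg [M gM]]; split; first exact: measurable_funM.
by exists (K * M) => x; rewrite normrM ler_pM.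
Qed.

Let bm_cst k : bounded_measurable (fun=> k).
Proof. by split; [exact: measurable_cst|exists `|k|]. Qed.

Let bm_cos th c : bounded_measurable (fun x => cos (th * x + c)).
Proof.
split; last by exists 1 => x; exact: norm_cos_le1.
apply: (measurableT_comp (@measurable_cos R)).
by apply: measurable_funD => //; exact: measurable_funM.
Qed.

Let bm_cvg (f_ : nat -> R -> R) (f : R -> R) (K : R) : (forall n, measurable_fun setT (f_ n)) ->
  (forall n x, `|f_ n x| <= K) -> (forall x, f_ ^~ x @ \oo --> f x) ->
  bounded_measurable f.
Proof.
move=> mf fK cf; split.
  by apply: (measurable_fun_cvg (h := f_)) => // x _; exact: cf.
exists K => x.
apply: (@closed_cvg _ _ _ eventually_filter (fun n => `|f_ n x|) [set y | y <= K]).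
- exact: closed_le.
- by apply: nearW => n; exact: fK.
- by apply: cvg_norm; exact: cf.
Qed.

(* The class mult is an algebra containing the cosines and closed under bounded
   pointwise limits; hence it contains the indicators of half-lines, through
   the sign function, and those of all Borel sets *)
Local Definition null (f : R -> R) : Prop := bounded_measurable f /\
  forall th c, L (fun x => f x * cos (th * x + c)) = 0.

Local Definition mult (m : R -> R) : Prop := bounded_measurable m /\
  forall f, null f -> null (fun x => f x * m x).

Let nullD f g : null f -> null g -> null (fun x => f x + g x).
Proof.
move=> [bf nf] [bg ng]; split; first exact: bmD.
move=> th c; under eq_fun do rewrite mulrDl.
by rewrite LD ?nf ?ng ?addr0//; exact: bmM.
Qed.

Let nullZ k f : null f -> null (fun x => k * f x).
Proof.
move=> [bf nf]; split; first exact: bmM.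
move=> th c; under eq_fun do rewrite -mulrA.
by rewrite LZ ?nf ?mulr0//; exact: bmM.
Qed.

Let null_cvg (f_ : nat -> R -> R) (f : R -> R) (K : R) : (forall n, null (f_ n)) ->
  (forall n x, `|f_ n x| <= K) -> (forall x, f_ ^~ x @ \oo --> f x) -> null f.
Proof.
move=> nf fK cf; have mf n : measurable_fun setT (f_ n) by case: (nf n) => -[].
split; first exact: bm_cvg cf.
move=> th c; have [mc _] := bm_cos th c.
have := @Lcvg (fun n x => f_ n x * cos (th * x + c))
  (fun x => f x * cos (th * x + c)) K.
have -> : (fun n => L (fun x => f_ n x * cos (th * x + c))) = cst 0.
  by apply/funext => n; case: (nf n) => _ ->.
move=> /(_ _ _ _)/(cvg_unique (@Rhausdorff R) (cvg_cst 0)) <- //.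
- by move=> n; exact: measurable_funM.
- by move=> n x; rewrite normrM (le_trans _ (fK n x))// ler_piMr ?norm_cos_le1.
- by move=> x; apply: cvgM; [exact: cf|exact: cvg_cst].
Qed.

Let mult_cst k : mult (fun=> k).
Proof.
by split=> // f nf; under eq_fun do rewrite mulrC; exact: nullZ.
Qed.

Let multD m n : mult m -> mult n -> mult (fun x => m x + n x).
Proof.
move=> [bm Mm] [bn Mn]; split; first exact: bmD.
by move=> f nf; under eq_fun do rewrite mulrDr; apply: nullD; [exact: Mm|exact: Mn].
Qed.

Let multM m n : mult m -> mult n -> mult (fun x => m x * n x).
Proof.
move=> [bm Mm] [bn Mn]; split; first exact: bmM.
by move=> f nf; under eq_fun do rewrite mulrA; apply: Mn; exact: Mm.
Qed.

Let mult_cvg (m_ : nat -> R -> R) (m : R -> R) (K : R) : (forall n, mult (m_ n)) ->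
  (forall n x, `|m_ n x| <= K) -> (forall x, m_ ^~ x @ \oo --> m x) -> mult m.
Proof.
move=> Mm mK cm; split.
  by apply: (bm_cvg _ mK cm) => n; case: (Mm n) => -[].
move=> f nf; have [[mf [M fM]] _] := nf.
apply: (@null_cvg (fun n x => f x * m_ n x) _ (M * K)).
- by move=> n; case: (Mm n) => _; apply.
- by move=> n x; rewrite normrM ler_pM.
- by move=> x; apply: cvgM; [exact: cvg_cst|exact: cm].
Qed.

(** By the product-to-sum formula, multiplying a test cosine by a cosine gives a combination of test
    cosines. *)
Let mult_cos a b : mult (fun x => cos (a * x + b)).
Proof.
split=> // f nf; have [bf Nf] := nf; split; first exact: bmM.
move=> th c.
have E x : f x * cos (a * x + b) * cos (th * x + c) =
  2^-1 * (f x * cos ((a + th) * x + (b + c))) +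
  2^-1 * (f x * cos ((a - th) * x + (b - c))).
  have -> : (a + th) * x + (b + c) = (a * x + b) + (th * x + c) by ring.
  have -> : (a - th) * x + (b - c) = (a * x + b) - (th * x + c) by ring.
  by move: (a * x + b) (th * x + c) => u v; rewrite cosD cosB; field.
rewrite (funext E) LD; [|do 2 apply: bmM => //..].
by rewrite !LZ ?Nf ?mulr0 ?addr0//; exact: bmM.
Qed.

(** The constant 1 is null by [Lcos], hence so is 1 * m, which is then tested against cos 0 = 1. *)
Let mult_null m : mult m -> L m = 0.
Proof.
move=> [bm Mm]; have n1 : null (fun=> 1).
  by split => // th c; under eq_fun do rewrite mul1r; exact: Lcos.
have [_ /(_ 0 0)] := Mm _ n1.
by under eq_fun do rewrite mul1r mul0r addr0 cos0 mulr1.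
Qed.

Let mult_iter_sgpoly m n : mult m -> mult (fun x => iter n (@sgpoly R) (m x)).
Proof.
move=> Mm; elim: n => // n IHn; set g := fun x => iter n (@sgpoly R) (m x) in IHn.
have -> : (fun x => iter n.+1 (@sgpoly R) (m x)) =
    (fun x => (3 / 2) * g x + (- 2^-1) * (g x * (g x * g x))).
  by apply/funext => x; rewrite /= -/(g x) /sgpoly; field.
apply: multD; first exact: multM.
by do 3 apply: multM => //.
Qed.

(** Two nested limits: iterated polynomials of a sine give the sign of that sine, then slower and
    slower sines give the sign of x - c. *)
Let mult_sg c : mult (fun x => Num.sg (x - c)).
Proof.
have sgb (y : R) : `|Num.sg y| <= 1.
  by rewrite normr_sg; case: (_ != _); rewrite ?ler01.
apply: (@mult_cvg (fun n x => Num.sg (sin ((x - c) / n.+1%:R))) _ 1) => //; last first.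
  by move=> x; exact: sg_sin_cvg.
move=> n.
apply: (@mult_cvg (fun k x => iter k (@sgpoly R) (sin ((x - c) / n.+1%:R))) _ 1).
- move=> k; apply: mult_iter_sgpoly.
  have -> : (fun x : R => sin ((x - c) / n.+1%:R)) =
      (fun x => cos (n.+1%:R^-1 * x + (- c / n.+1%:R - pi / 2))).
    apply/funext => x; rewrite addrA cosB cos_pihalf sin_pihalf mulr0 mulr1 add0r.
    by congr sin; ring.
  exact: mult_cos.
- by move=> k x; apply: iter_sgpoly_norm_le1; exact: norm_sin_le1.
- by move=> x; apply: iter_sgpoly_cvg; exact: norm_sin_le1.
Qed.

Local Definition Mset : set_system R := [set U | measurable U /\ mult (\1_U)].

Let Mset_ray c : Mset `]c, +oo[%classic.
Proof.
split; first exact: measurable_itv.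
have -> : \1_`]c, +oo[%classic = (fun x : R => 2^-1 * (Num.sg (x - c) +
    Num.sg (x - c) * Num.sg (x - c))).
  apply/funext => x; rewrite indicE mem_setE in_itv/= andbT.
  have [cx|xc|->] := ltrgtP c x.
  - by rewrite gtr0_sg ?subr_gt0//= mulr1n; field.
  - by rewrite ltr0_sg ?subr_lt0//= mulr0n; field.
  - by rewrite subrr sgr0/= mulr0n; field.
by apply: multM => //; apply: multD => //; exact: multM.
Qed.

(** As the class is an algebra, it allows inclusion-exclusion: finite unions are reached directly,
    countable ones by a bounded limit, with no monotone class argument. *)
Let Mset_sigma : sigma_algebra setT Mset.
Proof.
split.
- split => //; rewrite indic0; exact: mult_cst.
- move=> A [mA MA]; split; first exact: measurableD.
  have -> : \1_([set: R] `\` A) = (fun x : R => 1 + (-1) * \1_A x) :> (R -> R).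
    apply/funext => x; rewrite setTD !indicE in_setC.
    by case: (x \in A) => /=; rewrite ?mulr1n ?mulr0n; ring.
  by apply: multD => //; exact: multM.
- move=> A MA; have mA n : measurable (A n) by case: (MA n).
  split; first exact: bigcup_measurable.
  pose B n := \big[setU/set0]_(i < n) A i.
  apply: (@mult_cvg (fun n => \1_(B n)) _ 1).
  + elim=> [|n IHn].
      by rewrite /B big_ord0 indic0; exact: mult_cst.
    have -> : \1_(B n.+1) = (fun x : R => \1_(B n) x + (\1_(A n) x +
        (-1) * (\1_(B n) x * \1_(A n) x))) :> (R -> R).
      apply/funext => x; rewrite /B big_ord_recr/= !indicE in_setU.
      by case: (_ \in _) => /=; case: (_ \in _) => /=; rewrite ?mulr1n ?mulr0n; ring.
    have MAn : mult (\1_(A n)) by case: (MA n).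
    apply: multD => //; apply: multD => //; apply: multM => //; exact: multM.
  + by move=> n x; rewrite indicE; case: (_ \in _); rewrite ?normr1 ?normr0.
  + move=> x; have [xA|xA] := pselect ((\bigcup_n A n) x).
      have [n _ Anx] := xA.
      rewrite indicE mem_set//; apply: cvg_near_cst; exists n.+1 => // m /= nm.
      rewrite indicE mem_set// /B -bigcup_mkord; exists n => //.
    rewrite indicE memNset//; apply: cvg_near_cst; apply: nearW => m.
    rewrite indicE memNset// /B -bigcup_mkord => -[i _ Aix]; apply: xA.
    by exists i.
Qed.

Lemma trigonometric_uniqueness U : measurable U -> L (\1_U) = 0.
Proof.
move=> mU; apply: mult_null; suff : Mset U by case.
have mU' : (@ocitv R).-sigma.-measurable U := mU.
move: mU'; rewrite RGenOInfty.measurableE; apply: smallest_sub => //.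
by move=> _ [c ->]; exact: Mset_ray.
Qed.

End trigonometric_uniqueness.

(** * From the invariant to Brownian motion *)

Section gaussian_pair_brownian.
Context d (T : measurableType d) (R : realType) (P : probability T R).
Context (F : R -> set_system T) (Ffilt : filtration F).

(** The two measures compared are the law of Z restricted to A and P A times the law of Z'. One
    identity thus yields both the law of Z and its independence of A. *)
Lemma law_of_cos (Z Z' : T -> R) A : measurable_fun setT Z ->
  measurable_fun setT Z' -> measurable A ->
  (forall th c, Ex P (fun w => \1_A w * cos (th * Z w + c)) =
    fine (P A) * Ex P (fun w => cos (th * Z' w + c))) ->
  forall U, measurable U -> P (A `&` Z @^-1` U) = (P A * P (Z' @^-1` U))%E.
Proof.
move=> mZ mZ' mA cosE U mU.
have mAf (f : R -> R) : measurable_fun setT f -> measurable_fun setT (fun w => \1_A w * f (Z w)).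
  move=> mf; apply: measurable_funM; first exact: measurable_indic.
  exact: measurableT_comp.
have iA (f : R -> R) : bounded_measurable f -> intg P (fun w => \1_A w * f (Z w)).
  move=> [mf [K fK]]; apply: (@intg_bounded _ _ _ P (fun w => \1_A w * f (Z w)) K (mAf f mf)) => w.
  exact: norm_indicM_le.
have iZ' (f : R -> R) : bounded_measurable f -> intg P (fun w => f (Z' w)).
  by move=> [mf [K fK]]; apply: (@intg_bounded _ _ _ _ _ K) => //; exact: measurableT_comp.
pose L (f : R -> R) := Ex P (fun w => \1_A w * f (Z w)) - fine (P A) * Ex P (fun w => f (Z' w)).
have mpre (V : T -> R) : measurable_fun setT V -> measurable (V @^-1` U).
  by move=> mV; rewrite -[X in measurable X]setTI; exact: mV.
suff : L (\1_U) = 0.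
  rewrite /L (Ex_eq P (g := \1_(A `&` Z @^-1` U))); last by move=> w; rewrite indicI.
  rewrite (Ex_eq P (g := \1_(Z' @^-1` U)) (f := fun w => \1_U (Z' w)))//.
  rewrite !Ex_indic; [|exact: mpre|by apply: measurableI => //; exact: mpre].
  move=> /eqP; rewrite subr_eq0 => /eqP E.
  rewrite -[LHS]fineK ?fin_num_measure//; last by apply: measurableI => //; exact: mpre.
  by rewrite E EFinM !fineK ?fin_num_measure//; exact: mpre.
apply: trigonometric_uniqueness => //.
- move=> f g bf bg; rewrite /L.
  under eq_fun do rewrite mulrDr.
  by rewrite (ExD (iA _ bf) (iA _ bg)) (ExD (iZ' _ bf) (iZ' _ bg)); ring.
- move=> k f bf; rewrite /L.
  under eq_fun do rewrite mulrCA.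
  by rewrite (ExZ _ (iA _ bf)) (ExZ _ (iZ' _ bf)); ring.
- move=> f_ f K mf fK cf.
  have mfl : measurable_fun setT f.
    by apply: (measurable_fun_cvg (h := f_)) => // x _; exact: cf.
  apply: cvgB.
    apply: (Ex_cvg_bounded (K := K)).
    + by move=> n; exact: mAf.
    + exact: mAf.
    + by apply: aeW => w; apply: cvgM; [exact: cvg_cst|exact: cf].
    + by move=> n w; exact: norm_indicM_le.
  apply: cvgM; first exact: cvg_cst.
  apply: (Ex_cvg_bounded (K := K)).
  + by move=> n; exact: measurableT_comp.
  + exact: measurableT_comp.
  + by apply: aeW => w; exact: cf.
  + by move=> n w.
- by move=> th c; rewrite /L cosE subrr.
Qed.

(** Since the cosine transform of the normal law has not been computed, it is read off the
    increments of [BX], with coefficients (th, 0); (th a, th b) has the same sum of squares because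
    (a, b) is a unit vector. *)
Lemma gaussian_pair_brownian (BX BY U V : R -> T -> R) (a b : R) :
  brownian_motion P F BX -> gaussian_pair P F BX BY -> gaussian_pair P F U V ->
  a ^+ 2 + b ^+ 2 = 1 ->
  (\forall w \ae P, continuous_path_from0 (fun t w => a * U t w + b * V t w) w) ->
  brownian_motion P F (fun t w => a * U t w + b * V t w).
Proof.
move=> BXbm [aX _ EXY] [aU aV EUV] ab1 cont.
have aZ : adapted F (fun t w => a * U t w + b * V t w).
  move=> t t0; have sF := filtration_algebra Ffilt t0.
  have : Gmeas (F t) (fun w => a * U t w + b * V t w).
    by apply: (GmeasD sF); apply: (GmeasZ sF); [exact: aU|exact: aV].
  exact.
split => // s t s0 st; have t0 : 0 <= t by rewrite ltW// (le_lt_trans s0).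
pose Z w := a * U t w + b * V t w - (a * U s w + b * V s w).
pose Z' w := BX t w - BX s w.
have mZ : measurable_fun setT Z.
  by apply: measurable_funB; apply: (adapted_measurable Ffilt aZ).
have mZ' : measurable_fun setT Z'.
  by apply: measurable_funB; apply: (adapted_measurable Ffilt aX).
have [_ lawX] := brownian_normal_law Ffilt BXbm s0 st.
have law A D : F s A -> measurable D ->
    P (A `&` Z @^-1` D) = (P A * normal_prob 0 (Num.sqrt (t - s)) D)%E.
  move=> FA mD; rewrite -lawX//.
  apply: law_of_cos => //; first exact: (filtration_measurable Ffilt s0).
  move=> th c.
  have := EUV s t A (th * a) (th * b) c s0 st FA.
  rewrite (_ : (th * a) ^+ 2 + (th * b) ^+ 2 = th ^+ 2); last first.
    by rewrite !exprMn -mulrDr ab1 mulr1.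
  rewrite (Ex_eq P (g := fun w => \1_A w * cos (th * Z w + c))); last first.
    by move=> w; congr (_ * cos _); rewrite /Z; ring.
  move=> ->.
  have := EXY s t setT th 0 c s0 st (G_setT (filtration_algebra Ffilt s0)).
  rewrite (expr0n _ 2) addr0 probability_setT/= mul1r.
  rewrite (Ex_eq P (g := fun w => cos (th * Z' w + c))); last first.
    by move=> w; rewrite indicT mul1r mul0r addr0.
  by move=> ->; ring.
have lawZ D : measurable D -> P (Z @^-1` D) = normal_prob 0 (Num.sqrt (t - s)) D.
  move=> mD; have := law setT D (G_setT (filtration_algebra Ffilt s0)) mD.
  by rewrite setTI probability_setT mul1e.
split; last exact: lawZ.
by move=> A _ FA [D mD <-]; rewrite setTI law// lawZ.
Qed.

End gaussian_pair_brownian.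

(** * Continuity on the half-line *)

Section half_line_continuity.
Context (R : realType).
Implicit Types f g : R -> R.

Lemma within_half_lineP f : {within `[0, +oo[, continuous f} <->
  forall r e, 0 <= r -> 0 < e -> exists2 del, 0 < del &
    forall x, 0 <= x -> `|x - r| < del -> `|f x - f r| < e.
Proof.
split=> [/subspace_continuousP cf r e r0 e0|cf].
  have r_in : `[0, +oo[%classic r by rewrite /= in_itv/= andbT.
  have /cvgrPdist_lt/(_ e e0) := cf r r_in.
  rewrite /prop_near1 /within /= => /nbhs_ballP[del /= del0 delP].
  exists del => // x x0 xr; rewrite distrC; apply: delP.
    by rewrite /ball/= distrC.
  by rewrite in_itv/= andbT.
apply/subspace_continuousP => r; rewrite /= in_itv/= andbT => r0.
apply/cvgrPdist_lt => e e0; have [del del0 delP] := cf r e r0 e0.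
apply/nbhs_ballP; exists del => //= x; rewrite /ball/= => rx.
by rewrite in_itv/= andbT => x0; rewrite distrC; apply: delP; rewrite // distrC.
Qed.

Lemma half_line_cvg f (x_ : nat -> R) (r : R) : {within `[0, +oo[, continuous f} ->
  0 <= r -> (forall n, 0 <= x_ n) -> x_ n @[n --> \oo] --> r ->
  f (x_ n) @[n --> \oo] --> f r.
Proof.
move=> /within_half_lineP cf r0 x0 xr; apply/cvgrPdist_lt => e e0.
have [del del0 delP] := cf r e r0 e0.
have /cvgrPdist_lt/(_ del del0) := xr; apply: filterS => n xn.
by rewrite distrC; apply: delP => //; rewrite distrC.
Qed.

End half_line_continuity.

(** * Almost sure limits in a complete sigma-algebra *)

Section almost_sure_limit.
Context d (T : measurableType d) (R : realType) (P : probability T R).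
Context (G : set_system T) (sG : sigma_algebra setT G).
Hypothesis Gnull : forall N, P.-negligible N -> G N.

(** Off the set N of divergence the limit is a pointwise one; on N, [G] contains every subset,
    whatever the values of [f] there. *)
Lemma Gmeas_ae_cvg (f_ : nat -> T -> R) (f : T -> R) :
  (forall n, Gmeas G (f_ n)) -> (\forall w \ae P, f_ ^~ w @ \oo --> f w) ->
  Gmeas G f.
Proof.
move=> Gf cf; pose N := ~` [set w | f_ ^~ w @ \oo --> f w].
have nN : P.-negligible N by exact: cf.
have GN := Gnull nN.
have GNC : Gmeas G (\1_(~` N) : T -> R).
  by apply: (@Gmeas_indic _ R _ sG); exact: (G_setC sG).
pose g_ n w := \1_(~` N) w * f_ n w; pose g w := \1_(~` N) w * f w.
have Gg : Gmeas G g.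
  apply/(GmeasP sG).
  apply: (@measurable_fun_cvg _ _ _ [set: g_sigma_algebraType G] g_).
    by move=> n; apply/(GmeasP sG); exact: (GmeasM sG GNC).
  move=> w _; rewrite /g_ /g; have [Nw|Nw] := pselect (N w).
    have wN : w \notin ~` N by rewrite in_setC negbK; exact: mem_set.
    rewrite indicE (negbTE wN) mulr0n.
    by under eq_cvg do rewrite mul0r; rewrite mul0r; exact: cvg_cst.
  by apply: cvgM; [exact: cvg_cst|exact: contrapT].
move=> U mU.
have -> : f @^-1` U = (~` N `&` g @^-1` U) `|` (N `&` f @^-1` U).
  apply/seteqP; split => [w Uw|w [[Nw]|[]//]].
    have [Nw|Nw] := pselect (N w); [by right|left; split => //].
    by rewrite /= /g indicE mem_set// mul1r.
  by rewrite /= /g indicE mem_set// mul1r.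
have GU A B : G A -> G B -> G (A `|` B).
  by rewrite -(measurable_g_measurableTypeE sG); exact: measurableU.
apply: GU.
  by apply: (G_setI sG); [exact: (G_setC sG)|exact: Gg].
by apply: Gnull; apply: (negligibleS _ nN) => w [].
Qed.

End almost_sure_limit.

(** * Continuity of reflected paths *)

Section reflected_path.
Context (R : realType) (T : Type).

(** The minimum of tau and t, as a real number: the reflected process is 2 B at this time minus B_t,
    before and after tau alike, and its continuity follows because this time is 1-Lipschitz in t. *)
Definition min_time (tau : \bar R) (t : R) : R :=
  if (tau <= t%:E)%E then fine tau else t.

Lemma reflectionE (B : R -> T -> R) (tau : T -> \bar R) t w :
  reflection B tau t w = 2 * B (min_time (tau w) t) w - B t w.
Proof.
by rewrite /reflection /min_time; case: ifP => _ /=; rewrite ?mulr1n ?mulr0n; ring.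
Qed.

Lemma min_time_ge0 (tau : \bar R) t : (0 <= tau)%E -> 0 <= t -> 0 <= min_time tau t.
Proof. by move=> tau0 t0; rewrite /min_time; case: ifP => // _; exact: fine_ge0. Qed.

Lemma min_time_dist (tau : \bar R) x y :
  `|min_time tau x - min_time tau y| <= `|x - y|.
Proof.
case: tau => [r||]; rewrite /min_time; last 2 first.
- by rewrite !leye_eq.
- by rewrite !leNye/= subrr normr0.
rewrite !lee_fin/=; case: (leP r x) => rx; case: (leP r y) => ry.
- by rewrite subrr normr0.
- by rewrite !ger0_norm ?subr_ge0; lra.
- by rewrite !ler0_norm ?subr_le0; lra.
- by [].
Qed.

Lemma reflection_path (B : R -> T -> R) (tau : T -> \bar R) w :
  (0 <= tau w)%E -> continuous_path_from0 B w ->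
  continuous_path_from0 (reflection B tau) w.
Proof.
move=> tau0 [B0 /within_half_lineP cB]; split.
  rewrite reflectionE /min_time; case: ifP => [tau_le0|_]; last by rewrite B0; ring.
  have -> : tau w = 0%E by apply/eqP; rewrite eq_le tau_le0.
  by rewrite /= B0; ring.
apply/within_half_lineP => r e r0 e0.
have e40 : 0 < e / 4 by rewrite divr_gt0.
have [d1 d10 d1P] := cB r (e / 4) r0 e40.
have m0 := min_time_ge0 tau0.
have [d2 d20 d2P] := cB (min_time (tau w) r) (e / 4) (m0 _ r0) e40.
exists (Num.min d1 d2); first by rewrite lt_min d10.
move=> x x0; rewrite lt_min => /andP[xd1 xd2]; rewrite !reflectionE.
have h1 := d1P x x0 xd1.
have h2 := d2P _ (m0 _ x0) (le_lt_trans (min_time_dist _ _ _) xd2).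
move: h1 h2; rewrite !ltr_norml => /andP[? ?] /andP[? ?]; apply/andP; split; lra.
Qed.

End reflected_path.

(** * Reflection at a stopping time preserves the invariant *)

Section reflection.
Context d (T : measurableType d) (R : realType) (P : probability T R).
Context (F : R -> set_system T) (Ffilt : filtration F).
Hypothesis Fusual : usual_conditions P F.

Lemma filtration_null t N : 0 <= t -> P.-negligible N -> F t N.
Proof. by move=> t0 nN; apply: (filtration_le Ffilt (lexx 0) t0); exact: Fusual.1. Qed.

Section discretization.
Variables (U V : R -> T -> R).
Hypothesis UV : gaussian_pair P F U V.

Let aU : adapted F U. Proof. by case: UV. Qed.
Let aV : adapted F V. Proof. by case: UV. Qed.

(** The constant phases 0 and - pi / 2 show that, given F_s, the cosine of the increment has mean
    psi and its sine has mean 0; the addition formula then allows a phase [W] known at time s. *)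
Lemma gaussian_pair_step s t A (W : T -> R) a b : 0 <= s -> s < t -> F s A ->
  Gmeas (F s) W ->
  Ex P (fun w => \1_A w * cos (W w + (a * (U t w - U s w) + b * (V t w - V s w)))) =
  Ex P (fun w => \1_A w * cos (W w)) * cos_normal (t - s) (a ^+ 2 + b ^+ 2).
Proof.
move=> s0 st FA GW; have [_ _ E] := UV.
have sF := filtration_algebra Ffilt s0.
have Fm := filtration_measurable Ffilt s0.
have t0 : 0 <= t by rewrite ltW// (le_lt_trans s0).
pose X w := a * (U t w - U s w) + b * (V t w - V s w).
have mX : measurable_fun setT X.
  by apply: measurable_funD; apply: measurable_funM => //; apply: measurable_funB;
    exact: (adapted_measurable Ffilt).
have mcos := @measurable_cos R; have msin := @measurable_sin R.
have icX : intg P (fun w => cos (X w)).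
  apply: (@intg_bounded _ _ _ _ _ 1); first exact: (measurableT_comp mcos mX).
  by move=> w; exact: norm_cos_le1.
have isX : intg P (fun w => sin (X w)).
  apply: (@intg_bounded _ _ _ _ _ 1); first exact: (measurableT_comp msin mX).
  by move=> w; exact: norm_sin_le1.
set psi := cos_normal _ _.
have EcX B : F s B -> Ex P (fun w => \1_B w * cos (X w)) = psi * fine (P B).
  move=> FB; have := E s t B a b 0 s0 st FB; rewrite cos0 mulr1 mulrC => <-.
  by apply: Ex_eq => w; rewrite addr0.
have EsX B : F s B -> Ex P (fun w => \1_B w * sin (X w)) = 0 * fine (P B).
  move=> FB; have := E s t B a b (- (pi / 2)) s0 st FB.
  rewrite cosN cos_pihalf mulr0 !mul0r => <-.
  by apply: Ex_eq => w; rewrite cosB cos_pihalf sin_pihalf mulr0 mulr1 add0r.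
have GA := @Gmeas_indic _ R _ sF _ FA.
have mA := Fm _ FA.
have Gc : Gmeas (F s) (fun w => \1_A w * cos (W w)).
  by apply: (GmeasM sF GA); apply: (Gmeas_comp sF mcos GW).
have Gs : Gmeas (F s) (fun w => \1_A w * sin (W w)).
  by apply: (GmeasM sF GA); apply: (Gmeas_comp sF msin GW).
have mc := Gmeas_measurable Fm Gc; have ms := Gmeas_measurable Fm Gs.
have bc w : `|\1_A w * cos (W w)| <= 1 by apply: norm_indicM_le; exact: norm_cos_le1.
have bs w : `|\1_A w * sin (W w)| <= 1 by apply: norm_indicM_le; exact: norm_sin_le1.
have ic : intg P (fun w => \1_A w * cos (W w)) by exact: intg_bounded mc bc.
have is_ : intg P (fun w => \1_A w * sin (W w)) by exact: intg_bounded ms bs.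
have icc : intg P (fun w => \1_A w * cos (W w) * cos (X w)).
  apply: (@intg_bounded _ _ _ _ _ 1).
    by apply: measurable_funM => //; exact: (measurableT_comp mcos mX).
  by move=> w; rewrite normrM mulr_ile1// norm_cos_le1.
have iss : intg P (fun w => \1_A w * sin (W w) * sin (X w)).
  apply: (@intg_bounded _ _ _ _ _ 1).
    by apply: measurable_funM => //; exact: (measurableT_comp msin mX).
  by move=> w; rewrite normrM mulr_ile1// norm_sin_le1.
rewrite (Ex_eq P (g := fun w => \1_A w * cos (W w) * cos (X w) -
    \1_A w * sin (W w) * sin (X w))); last by move=> w; rewrite cosD -/(X w); ring.
rewrite (ExB icc iss) (Ex_projection sF Fm icX EcX Gc ic icc).
by rewrite (Ex_projection sF Fm isX EsX Gs is_ iss) mul0r subr0 mulrC.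
Qed.

(* When D l is the event tau <= u l, this discretizes the increment of the
   process reflected at tau: the increments of U are flipped from the first
   grid point after tau on *)
Definition signed_sum (u : nat -> R) (D : nat -> set T) n w : R :=
  \sum_(l < n) (1 - 2 * \1_(D l) w) * (U (u l.+1) w - U (u l) w).

Lemma Gmeas_signed_sum (u : nat -> R) (D : nat -> set T) n t :
  0 <= t -> (forall l, (l <= n)%N -> 0 <= u l <= t) ->
  (forall l, (l < n)%N -> F (u l) (D l)) ->
  Gmeas (F t) (signed_sum u D n).
Proof.
move=> t0; have sF := filtration_algebra Ffilt t0.
rewrite /signed_sum; elim: n => [|n IHn] ut FD.
  under eq_fun do rewrite big_ord0; exact: (Gmeas_cst sF).
under eq_fun do rewrite big_ord_recr/=.
apply: (GmeasD sF); first by apply: IHn => l ln; [exact/ut/leqW|exact/FD/leqW].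
have /andP[un0 unt] := ut n (leqnSn n); have /andP[um0 umt] := ut n.+1 (leqnn _).
apply: (GmeasM sF); last exact: (Gmeas_increment Ffilt).
apply: (GmeasB sF); first exact: (Gmeas_cst sF).
apply: (GmeasZ sF); apply: (@Gmeas_indic _ R _ sF).
by apply: (filtration_le Ffilt un0 unt); exact: FD.
Qed.

(** The event A is cut along [D n], which is known at the beginning of the last step. On each piece
    the sign is constant, both pieces pick up the same factor, and they recombine. *)
Lemma Ex_signed_sum s h (D : nat -> set T) n A a b c : 0 <= s -> 0 < h ->
  (forall l, F (grid s h l) (D l)) -> F s A ->
  Ex P (fun w => \1_A w * cos (a * signed_sum (grid s h) D n w +
    b * (V (grid s h n) w - V s w) + c)) =
  fine (P A) * cos c * cos_normal h (a ^+ 2 + b ^+ 2) ^+ n.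
Proof.
move=> s0 h0 FD FA; have sge l : s <= grid s h l by rewrite grid_ge// ltW.
have mA := filtration_measurable Ffilt s0 FA.
elim: n => [|n IHn].
  rewrite grid0 expr0 mulr1.
  rewrite (Ex_eq P (g := fun w => cos c * \1_A w)); last first.
    by move=> w; rewrite /signed_sum big_ord0 subrr !mulr0 !add0r mulrC.
  by rewrite ExZ ?Ex_indic 1?mulrC//; exact: integrable_indic.
set u := grid s h n; have u0 : 0 <= u := le_trans s0 (sge n).
have su : s <= u := sge n.
have uu : u < grid s h n.+1 by rewrite gridS ltrDl.
have uh : grid s h n.+1 - u = h by rewrite gridS /u; ring.
have sF := filtration_algebra Ffilt u0.
pose W w := a * signed_sum (grid s h) D n w + b * (V u w - V s w) + c.
have GW : Gmeas (F u) W.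
  apply: (GmeasD sF); last exact: (Gmeas_cst sF).
  apply: (GmeasD sF); apply: (GmeasZ sF); last exact: (Gmeas_increment Ffilt).
  apply: Gmeas_signed_sum => // l ln; rewrite (le_trans s0 (sge l))/=.
  by apply: grid_mono => //; exact: ltW.
have FAu : F u A by exact: (filtration_le Ffilt s0 (sge n) FA).
have FAD : F u (A `&` D n) by apply: (G_setI sF) => //; exact: FD.
have FAC : F u (A `&` ~` D n).
  by apply: (G_setI sF) => //; apply: (G_setC sF); exact: FD.
have := gaussian_pair_step (- a) b u0 uu FAD GW.
have := gaussian_pair_step a b u0 uu FAC GW.
rewrite uh sqrrN; set psi := cos_normal _ _ => E1 E2.
have mD := filtration_measurable Ffilt u0 (FD n).
have Fm := filtration_measurable Ffilt u0.
have split_indic (f : T -> R) w :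
    \1_A w * f w = \1_(A `&` D n) w * f w + \1_(A `&` ~` D n) w * f w.
  rewrite !indicE !in_setI in_setC; case: (w \in A); case: (w \in D n) => /=;
  rewrite ?mulr1n ?mulr0n; ring.
have ibc B (f : T -> R) : F u B -> measurable_fun setT f ->
    intg P (fun w => \1_B w * cos (f w)).
  move=> FB mf; apply: (@intg_bounded _ _ _ _ _ 1).
    apply: measurable_funM; first by apply: measurable_indic; exact: Fm.
    exact: (measurableT_comp (@measurable_cos R)).
  by move=> w; apply: norm_indicM_le; exact: norm_cos_le1.
have mW := Gmeas_measurable Fm GW.
have un0 : 0 <= grid s h n.+1 := le_trans s0 (sge _).
have mX a' : measurable_fun setT (fun w => W w +
    (a' * (U (grid s h n.+1) w - U u w) + b * (V (grid s h n.+1) w - V u w))).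
  apply: measurable_funD => //; apply: measurable_funD; apply: measurable_funM => //;
  by apply: measurable_funB; exact: (adapted_measurable Ffilt).
rewrite (Ex_eq P (g := fun w =>
  \1_(A `&` D n) w * cos (W w + (- a * (U (grid s h n.+1) w - U u w) +
     b * (V (grid s h n.+1) w - V u w))) +
  \1_(A `&` ~` D n) w * cos (W w + (a * (U (grid s h n.+1) w - U u w) +
     b * (V (grid s h n.+1) w - V u w))))); last first.
  move=> w; rewrite [LHS](split_indic (fun w => cos (a * signed_sum (grid s h) D n.+1 w +
    b * (V (grid s h n.+1) w - V s w) + c))); congr (_ + _); rewrite !indicE !in_setI ?in_setC.
    case: (w \in A); case Dw : (w \in D n); rewrite /= ?mulr0n ?mul0r//.
    congr (_ * cos _); rewrite /signed_sum big_ord_recr/= indicE Dw mulr1n /W /signed_sum -/u.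
    ring.
  case: (w \in A); case Dw : (w \in D n); rewrite /= ?mulr0n ?mul0r//.
  congr (_ * cos _); rewrite /signed_sum big_ord_recr/= indicE Dw mulr0n /W /signed_sum -/u.
  ring.
rewrite (ExD (ibc _ _ FAD (mX (- a))) (ibc _ _ FAC (mX a))) E1 E2 -mulrDl.
rewrite -(ExD (ibc _ _ FAD mW) (ibc _ _ FAC mW)).
rewrite -(Ex_eq P (split_indic (fun w => cos (W w)))).
by rewrite IHn -/psi [psi ^+ n.+1]exprSr mulrA.
Qed.

Lemma signed_sum_set0 s h n w :
  signed_sum (grid s h) (fun=> set0) n w = U (grid s h n) w - U s w.
Proof.
rewrite /signed_sum; elim: n => [|n IHn]; first by rewrite big_ord0 grid0 subrr.
by rewrite big_ord_recr/= IHn indic0/=; ring.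
Qed.

(** Multiplicativity without any computation: when no increment is flipped the signed sum
    telescopes, and the invariant over the whole interval evaluates the same expectation. *)
Lemma cos_normal_pow (h : R) n (a b : R) : 0 < h ->
  cos_normal h (a ^+ 2 + b ^+ 2) ^+ n.+1 =
  cos_normal (n.+1%:R * h) (a ^+ 2 + b ^+ 2).
Proof.
move=> h0; have F0 := G_setT (filtration_algebra Ffilt (lexx 0)).
have h1 : 0 < grid 0 h n.+1 by rewrite /grid add0r mulr_gt0.
have [_ _ E] := UV.
have g1 : grid 0 h n.+1 = n.+1%:R * h by rewrite /grid add0r.
have FD l : F (grid 0 h l) set0.
  rewrite -setCT; have g0 : 0 <= grid 0 h l by rewrite grid_ge// ltW.
  by apply: (G_setC (filtration_algebra Ffilt g0)); exact: (G_setT (filtration_algebra Ffilt g0)).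
have := @Ex_signed_sum 0 h (fun=> set0) n.+1 setT a b 0 (lexx 0) h0 FD F0.
rewrite g1 probability_setT cos0 !mul1r => <-.
have := E 0 _ setT a b 0 (lexx 0) h1 F0.
rewrite g1 probability_setT cos0 !mul1r subr0 => <-.
by apply: Ex_eq => w; rewrite signed_sum_set0 g1.
Qed.

End discretization.

Section reflect.
Variables (U V : R -> T -> R) (tau : T -> \bar R).
Hypotheses (UV : gaussian_pair P F U V) (tau_st : stopping_time F tau).
Hypothesis U_path : \forall w \ae P, continuous_path_from0 U w.

Let aU : adapted F U. Proof. by case: UV. Qed.
Let aV : adapted F V. Proof. by case: UV. Qed.

Let D s h l : set T := [set w | (tau w <= (grid s h l)%:E)%E].

Let FD s h l : 0 <= s -> 0 < h -> F (grid s h l) (D s h l).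
Proof.
move=> s0 h0; have [_] := tau_st; apply.
by rewrite (le_trans s0)// grid_ge// ltW.
Qed.

(** The events [D s h l] increase with l, so the signs change at most once and the sum telescopes on
    either side of the first grid point j at or after tau. *)
Lemma signed_sum_cases s h n w : 0 < h ->
  ((forall l, (l < n)%N -> ~ D s h l w) /\
    signed_sum U (grid s h) (D s h) n w = U (grid s h n) w - U s w) \/
  exists j, [/\ (j < n)%N, forall l, (l < j)%N -> ~ D s h l w, D s h j w &
    signed_sum U (grid s h) (D s h) n w =
    2 * U (grid s h j) w - U s w - U (grid s h n) w].
Proof.
move=> h0; elim: n => [|n [[nD IHn]|[j [jn nD Dj IHn]]]].
- by left; split => //; rewrite /signed_sum big_ord0 grid0 subrr.
- rewrite /signed_sum big_ord_recr/= -/(signed_sum U (grid s h) (D s h) n w) IHn.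
  have [Dn|nDn] := pselect (D s h n w).
    right; exists n; split => //; rewrite indicE mem_set//= mulr1n; ring.
  left; split; last by rewrite indicE memNset//= mulr0n; ring.
  by move=> l; rewrite ltnS leq_eqVlt => /predU1P[->|/nD].
- rewrite /signed_sum big_ord_recr/= -/(signed_sum U (grid s h) (D s h) n w) IHn.
  right; exists j; split => //; first exact: ltnW.
  rewrite indicE mem_set//= ?mulr1n; first ring.
  apply: le_trans Dj _; rewrite lee_fin; apply: grid_mono; exact: ltnW || exact: ltW.
Qed.

Lemma signed_sum_cvg s t w : 0 <= s -> s < t -> continuous_path_from0 U w ->
  signed_sum U (grid s ((t - s) / n.+1%:R)) (D s ((t - s) / n.+1%:R)) n.+1 w
    @[n --> \oo] --> reflection U tau t w - reflection U tau s w.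
Proof.
move=> s0 st [U0 cU]; pose h n := (t - s) / n.+1%:R.
have h0 n : 0 < h n by rewrite divr_gt0// subr_gt0.
have gn n : grid s (h n) n.+1 = t by rewrite grid_end.
have t0 : 0 <= t by rewrite ltW// (le_lt_trans s0).
have tau0 : (0 <= tau w)%E by case: tau_st.
rewrite !reflectionE /min_time.
have Dg s' n j : D s' (h n) j w = (tau w <= (grid s' (h n) j)%:E)%E by [].
have g_le n j : (j <= n.+1)%N -> grid s (h n) j <= t.
  by move=> jn; rewrite -(gn n); apply: grid_mono => //; exact: ltW.
have [ts|st'] := leP (tau w) s%:E.
  rewrite (le_trans ts) ?lee_fin ?(ltW st)//.
  apply: cvg_near_cst; apply: nearW => n.
  have [[/(_ 0%N (ltn0Sn _))]|[[|j] [_ nD _ ->]]] := signed_sum_cases s n.+1 w (h0 n).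
  - by rewrite /D grid0.
  - by rewrite grid0 gn; ring.
  - by have := nD 0%N (ltn0Sn _); rewrite /D grid0.
have [tt|tt] := leP (tau w) t%:E; last first.
  apply: cvg_near_cst; apply: nearW => n.
  have [[_ ->]|[j [jn _ Dj _]]] := signed_sum_cases s n.+1 w (h0 n).
    by rewrite gn; ring.
  have := lt_le_trans tt Dj; rewrite lte_fin ltNge g_le//; exact: ltnW.
set r := fine (tau w).
have tauE : tau w = r%:E.
  by rewrite fineK// ge0_fin_numE// (le_lt_trans tt)// ltry.
rewrite tauE lee_fin in tt; rewrite tauE lte_fin in st'.
have r0 : 0 <= r by rewrite (le_trans s0)// ltW.
(* g is the first grid point at or after tau. When tau falls in the last step, g = t and no
   increment has been flipped, but the formula still holds. *)
have ex n : exists g, [/\ r <= g, g <= r + h n &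
    signed_sum U (grid s (h n)) (D s (h n)) n.+1 w = 2 * U g w - U s w - U t w].
  have lt_r l : ~ D s (h n) l w -> grid s (h n) l < r.
    by rewrite /D/= tauE lee_fin => /negP; rewrite -ltNge.
  have [[nD E]|[[|j] [_ nD Dj E]]] := signed_sum_cases s n.+1 w (h0 n).
  - exists t; split => //; last by rewrite E gn; ring.
    by rewrite -(gn n) gridS lerD2r ltW// lt_r//; exact: nD.
  - by move: Dj; rewrite /D/= grid0 tauE lee_fin leNgt st'.
  - exists (grid s (h n) j.+1); split => //.
    + by move: Dj; rewrite /D/= tauE lee_fin.
    + by rewrite gridS lerD2r ltW// lt_r//; exact: nD.
    + by rewrite E gn.
have [g gP] := choice ex.
have E n : signed_sum U (grid s (h n)) (D s (h n)) n.+1 w =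
    2 * U (g n) w - U s w - U t w by case: (gP n).
under eq_cvg do rewrite E.
have gr : g n @[n --> \oo] --> (r : R).
  apply: (@squeeze_cvgr _ _ _ _ (cst r) (fun n => r + h n)).
  - by apply: nearW => n; case: (gP n) => -> ->.
  - exact: cvg_cst.
  - rewrite -[X in _ --> X]addr0; apply: cvgD; first exact: cvg_cst.
    rewrite -(mulr0 (t - s)); apply: cvgM; first exact: cvg_cst.
    exact: cvg_harmonic.
have g0 n : 0 <= g n by case: (gP n) => rg _ _; exact: le_trans rg.
have Ug := half_line_cvg cU r0 g0 gr.
rewrite (_ : _ - _ = 2 * U r w - U s w - U t w); last ring.
apply: cvgB; last exact: cvg_cst.
apply: cvgB; last exact: cvg_cst.
by apply: cvgM; [exact: cvg_cst|exact: Ug].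
Qed.

(** The value of [U] at tau is not directly seen to be known at time t. The reflected process is
    instead an almost sure limit of signed sums over [0, t], which are. *)
Lemma reflection_adapted : adapted F (reflection U tau).
Proof.
move=> t t0; have sF := filtration_algebra Ffilt t0.
have [_ tauF] := tau_st.
suff : Gmeas (F t) (reflection U tau t) by [].
(* At t = 0 there is no grid with positive steps, but the reflection changes nothing there. *)
move: t0; rewrite le_eqVlt => /predU1P[t0|t0].
  have -> : reflection U tau t = U t.
    apply/funext => w; rewrite reflectionE /min_time -t0.
    case: ifP => [tau_le0|_]; last by ring.
    have -> : tau w = 0%E by apply/eqP; rewrite eq_le tau_le0 (tau_st.1 w).
    by rewrite /=; ring.
  by apply: aU; rewrite -t0.
pose h n := t / n.+1%:R.
have h0 n : 0 < h n by rewrite divr_gt0.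
have gn n : grid 0 (h n) n.+1 = t.
  by have := @grid_end R 0 t n.+1 isT; rewrite subr0.
have Fnull N : P.-negligible N -> F t N by apply: filtration_null; exact: ltW.
apply: (Gmeas_ae_cvg sF Fnull (f_ := fun n w =>
  signed_sum U (grid 0 (h n)) (D 0 (h n)) n.+1 w)).
  move=> n; apply: (Gmeas_signed_sum UV (ltW t0)) => l ln; last exact: FD.
  rewrite grid_ge ?(ltW (h0 n))//=.
  by rewrite -[leRHS](gn n); apply: grid_mono; rewrite ?(ltW (h0 n)).
apply: filterS U_path => w Uw.
have := signed_sum_cvg (lexx 0) t0 Uw.
have [-> _] := reflection_path (tau_st.1 w) Uw.
by rewrite !subr0.
Qed.

(** By [cos_normal_pow] the signed sums have exactly the required transform for every n, so the
    limit is that of a constant sequence. *)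
Lemma gaussian_pair_reflection : gaussian_pair P F (reflection U tau) V.
Proof.
split; [exact: reflection_adapted|exact: aV|move=> s t A a b c s0 st FA].
have t0 : 0 <= t by rewrite ltW// (le_lt_trans s0).
pose h n := (t - s) / n.+1%:R.
have h0 n : 0 < h n by rewrite divr_gt0// subr_gt0.
have gn n : grid s (h n) n.+1 = t by rewrite grid_end.
have mA := filtration_measurable Ffilt s0 FA.
have mcos := @measurable_cos R.
have mV : measurable_fun setT (fun w => V t w - V s w).
  by apply: measurable_funB; exact: (adapted_measurable Ffilt).
have mR : measurable_fun setT (fun w => reflection U tau t w - reflection U tau s w).
  by apply: measurable_funB; exact: (adapted_measurable Ffilt reflection_adapted).
have mf (f : T -> R) : measurable_fun setT f -> measurable_fun setT
    (fun w => \1_A w * cos (a * f w + b * (V t w - V s w) + c)).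
  move=> mf; apply: measurable_funM; first exact: measurable_indic.
  apply: (measurableT_comp mcos); apply: measurable_funD => //.
  by apply: measurable_funD; exact: measurable_funM.
pose S n := signed_sum U (grid s (h n)) (D s (h n)) n.+1.
have mS n : measurable_fun setT (S n).
  apply: (Gmeas_measurable (filtration_measurable Ffilt t0)).
  apply: (Gmeas_signed_sum UV t0) => l ln; last exact: FD.
  rewrite (le_trans s0) ?grid_ge ?(ltW (h0 n))//=.
  by rewrite -[leRHS](gn n); apply: grid_mono; rewrite ?(ltW (h0 n)).
have c1 : Ex P (fun w => \1_A w * cos (a * S n w + b * (V t w - V s w) + c))
    @[n --> \oo] --> Ex P (fun w => \1_A w * cos (a * (reflection U tau t w -
      reflection U tau s w) + b * (V t w - V s w) + c)).
  apply: (Ex_cvg_bounded (K := 1)).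
  - by move=> n; exact: mf.
  - exact: mf.
  - apply: filterS U_path => w Uw; apply: cvgM; first exact: cvg_cst.
    apply: (cvg_comp (fun n => a * S n w + b * (V t w - V s w) + c) (@cos R));
      last exact: continuous_cos.
    apply: cvgD; last exact: cvg_cst.
    apply: cvgD; last exact: cvg_cst.
    apply: cvgM; first exact: cvg_cst.
    exact: signed_sum_cvg.
  - by move=> n w; apply: norm_indicM_le; exact: norm_cos_le1.
apply/esym/(cvg_unique (@Rhausdorff R) _ c1).
apply: cvg_near_cst; apply: nearW => n.
transitivity (Ex P (fun w => \1_A w * cos (a * signed_sum U (grid s (h n))
    (D s (h n)) n.+1 w + b * (V (grid s (h n) n.+1) w - V s w) + c))).
  by rewrite (gn n).
rewrite (Ex_signed_sum UV)//; last by move=> l; exact: FD.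
have hn : n.+1%:R * h n = t - s by rewrite /h mulrC divfK.
by have := cos_normal_pow UV n a b (h0 n); rewrite hn => ->.
Qed.

End reflect.

End reflection.

(** * Hitting times of a continuous path *)

Section hitting_path.
Context (R : realType) (T : Type).
Implicit Types (X Y : R -> T -> R) (tau : T -> \bar R).

Lemma next_hit_ge X Y a tau w : (tau w <= next_hit X Y a tau w)%E.
Proof. by apply: le_ereal_inf_tmp => _ [t [tau_t _] <-]. Qed.

(** If the difference were not a at the infimum r, continuity would keep it away from a just after
    r, where there must be hits. *)
Lemma next_hit_attained X Y a tau w : (0 <= tau w)%E ->
  {within `[0, +oo[, continuous (fun t => X t w - Y t w)} ->
  (next_hit X Y a tau w < +oo)%E ->
  [/\ next_hit X Y a tau w = (fine (next_hit X Y a tau w))%:E &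
      X (fine (next_hit X Y a tau w)) w - Y (fine (next_hit X Y a tau w)) w = a].
Proof.
move=> tau0 /within_half_lineP cD; set sig := next_hit _ _ _ _ _ => sig_fin.
have sig0 : (0 <= sig)%E by apply: le_trans (next_hit_ge X Y a tau w).
have sigE : sig = (fine sig)%:E by rewrite fineK// ge0_fin_numE.
split => //; set r := fine sig in sigE *.
have r0 : 0 <= r by rewrite -lee_fin -sigE.
apply/eqP/negPn/negP => Dra.
have e0 : 0 < `|X r w - Y r w - a| by rewrite normr_gt0 subr_eq0.
have [del del0 delP] := cD r _ r0 e0.
have : (sig < (r + del)%:E)%E by rewrite sigE lte_fin ltrDl.
move=> /ereal_inf_lt[_ [t [tau_t Dt] <-]]; rewrite lte_fin => t_lt.
have rt : r <= t.
  by rewrite -lee_fin -sigE; apply: ereal_inf_lbound; exists t.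
have tr : `|t - r| < del by rewrite ger0_norm ?subr_ge0// ltrBlDl.
by have := delP t (le_trans r0 rt) tr; rewrite Dt distrC ltxx.
Qed.

Lemma next_hit_leP X Y a tau w t : (0 <= tau w)%E ->
  {within `[0, +oo[, continuous (fun t => X t w - Y t w)} ->
  (next_hit X Y a tau w <= t%:E)%E <->
  exists2 r, (tau w <= r%:E)%E & r <= t /\ X r w - Y r w = a.
Proof.
move=> tau0 cD; split=> [le_t|[r tau_r [rt Dr]]]; last first.
  apply: (@le_trans _ _ r%:E); last by rewrite lee_fin.
  by apply: ereal_inf_lbound; exists r.
have [sigE Dsig] := next_hit_attained tau0 cD (le_lt_trans le_t (ltry _)).
exists (fine (next_hit X Y a tau w)); first by rewrite -sigE; exact: next_hit_ge.
by split => //; rewrite -lee_fin -sigE.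
Qed.

End hitting_path.

(** * Hitting times are stopping times *)

Section hitting_time.
Context d (T : measurableType d) (R : realType) (P : probability T R).
Context (F : R -> set_system T) (Ffilt : filtration F).
Hypothesis Fusual : usual_conditions P F.
Implicit Types (X Y : R -> T -> R) (tau : T -> \bar R).

Lemma G_ae_eq t (A B : set T) : 0 <= t -> F t A ->
  (\forall w \ae P, A w <-> B w) -> F t B.
Proof.
move=> t0 FA AB; have sF := filtration_algebra Ffilt t0.
have nN : P.-negligible (~` [set w | A w <-> B w]) by exact: AB.
have Fnull N : P.-negligible N -> F t N by exact: filtration_null.
set N := ~` _ in nN.
have -> : B = (A `&` ~` N) `|` (B `&` N).
  apply/seteqP; split=> [w Bw|w [[Aw /contrapT[+ _]]|[]//]]; last exact.
  have [Nw|Nw] := pselect (N w); [by right|left; split => //].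
  by move/contrapT : Nw => [_]; exact.
have FU C D : F t C -> F t D -> F t (C `|` D).
  by rewrite -(measurable_g_measurableTypeE sF); exact: measurableU.
apply: FU; first by apply: (G_setI sF) => //; apply: (G_setC sF); exact: Fnull.
by apply: Fnull; apply: (negligibleS _ nN) => w [].
Qed.

(* By compactness of [tau, t], the level a has been hit by time t iff the
   difference comes arbitrarily close to a at times t * q after tau, q rational
   in [0, 1]; including q = 1 covers a hit at time t *)
Lemma next_hit_stopping X Y a tau : adapted F X -> adapted F Y ->
  stopping_time F tau ->
  (\forall w \ae P, {within `[0, +oo[, continuous (fun t => X t w - Y t w)}) ->
  stopping_time F (next_hit X Y a tau).
Proof.
move=> aX aY [tau0 tauF] cD; split.
  by move=> w; apply: le_trans (next_hit_ge X Y a tau w).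
move=> t t0; have sF := filtration_algebra Ffilt t0.
pose Q (q : rat) := 0 <= ratr q :> R /\ ratr q <= 1 :> R.
pose B (m : nat) (q : rat) := [set w | [/\ Q q, (tau w <= (t * ratr q)%:E)%E &
  `|X (t * ratr q) w - Y (t * ratr q) w - a| < m.+1%:R^-1]].
have FB m q : F t (B m q).
  have [[q0 q1]|nQ] := pselect (Q q); last first.
    rewrite (_ : B m q = set0); last by apply/seteqP; split => // w [].
    by rewrite -setCT; apply: (G_setC sF); exact: (G_setT sF).
  have tq0 : 0 <= t * ratr q by rewrite mulr_ge0.
  have tqt : t * ratr q <= t by rewrite ler_piMr.
  rewrite (_ : B m q = [set w | (tau w <= (t * ratr q)%:E)%E] `&`
    (fun w => `|X (t * ratr q) w - Y (t * ratr q) w - a|) @^-1` `]-oo, m.+1%:R^-1[); last first.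
    apply/seteqP; split => w; rewrite /B /= in_itv/=; first by move=> [].
    by move=> [].
  apply: (G_setI sF); first by apply: (filtration_le Ffilt tq0 tqt); exact: tauF.
  have GD : Gmeas (F t) (fun w => X (t * ratr q) w - Y (t * ratr q) w - a).
    apply: (GmeasB sF); last exact: (Gmeas_cst sF).
    by apply: (GmeasB sF); apply: (adapted_le Ffilt).
  have mn : measurable_fun [set: R] (fun x : R => `|x|) by exact: normr_measurable.
  by apply: (Gmeas_comp sF mn GD); exact: measurable_itv.
apply: (@G_ae_eq t (\bigcap_m \bigcup_q B m q)) => //.
  rewrite -[X in F t X]setCK setC_bigcap; apply: (G_setC sF).
  apply: (G_bigcup sF) => // m; apply: (G_setC sF).
  by apply: (G_bigcup sF).
apply: filterS cD => w cDw; rewrite /= next_hit_leP//.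
have cD := (within_half_lineP _).1 cDw.
split=> [wB|[r tau_r [rt Dr]] m _]; last first.
  have r0 : 0 <= r by rewrite -lee_fin (le_trans (tau0 w)).
  have [rt_eq|rt_lt] : r = t \/ r < t.
    by move: rt; rewrite le_eqVlt => /predU1P; tauto.
    exists 1 => //; rewrite /B /Q /= rmorph1 mulr1; split.
    - by rewrite ler01 lexx.
    - by rewrite -rt_eq.
    - by rewrite -rt_eq Dr subrr normr0 invr_gt0.
  have t_gt0 : 0 < t by exact: le_lt_trans rt_lt.
  have m0 : 0 < m.+1%:R^-1 :> R by rewrite invr_gt0.
  have [del del0 delP] := cD r _ r0 m0.
  have /rat_in_itvoo[q] : r / t < Num.min 1 ((r + del) / t).
    rewrite lt_min ltr_pdivrMr// mul1r rt_lt/=.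
    by rewrite ltr_pM2r ?invr_gt0// ltrDl.
  rewrite in_itv/= lt_min ltr_pdivrMr// ltr_pdivlMr// => /andP[rq /andP[q1 qd]].
  exists q => //; rewrite mulrC in rq; rewrite mulrC in qd; split.
  - split; last exact: ltW.
    by rewrite -(pmulr_rge0 _ t_gt0) (le_trans r0)// ltW.
  - by rewrite (le_trans tau_r)// lee_fin ltW.
  - rewrite -[in X in _ - X]Dr; apply: delP; first by rewrite (le_trans r0)// ltW.
    by rewrite ger0_norm ?subr_ge0 ?ltW// ltrBlDl.
have ex m : exists2 q, Q q & (tau w <= (t * ratr q)%:E)%E /\
    `|X (t * ratr q) w - Y (t * ratr q) w - a| < m.+1%:R^-1.
  by have [q _ [Qq tq Dq]] := wB m I; exists q.
(* The witness for m = 0 only serves to show that tau is at most t, hence finite. *)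
have [q0 [q00 q01] [tau_q0 _]] := ex 0%N.
pose r := fine (tau w).
have tauE : tau w = r%:E.
  by rewrite fineK// ge0_fin_numE// (le_lt_trans tau_q0)// ltry.
have r0 : 0 <= r by rewrite -lee_fin -tauE.
have rt : r <= t.
  by rewrite -lee_fin -tauE (le_trans tau_q0)// lee_fin ler_piMr.
have cN : {within `[r, t], continuous (fun x => `|X x w - Y x w - a|)}.
  have sub : `[r, t]%classic `<=` `[0, +oo[%classic.
    by move=> x; rewrite /= !in_itv/= andbT => /andP[rx _]; exact: le_trans rx.
  apply: (continuous_subspaceW sub); apply/within_half_lineP => y e y0 e0.
  have [del del0 delP] := cD y e y0 e0; exists del => // x x0 xy.
  apply: le_lt_trans (delP x x0 xy); apply: (le_trans (ler_dist_dist _ _)).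
  by rewrite (_ : _ - _ = X x w - Y x w - (X y w - Y y w))//; ring.
(* The minimum of |X - Y - a| over [r, t] is below every 1 / (m + 1), hence zero: c is a hit. *)
have [c c_in c_min] := EVT_min rt cN.
move: c_in; rewrite in_itv/= => /andP[rc ct].
exists c; first by rewrite tauE lee_fin.
split => //; apply/eqP; rewrite -subr_eq0 -normr_le0.
apply/ler_addgt0Pr => e e0; rewrite add0r.
have [m me] : exists m : nat, m.+1%:R^-1 < e.
  exists (Num.truncn e^-1); rewrite -[ltRHS]invrK ltf_pV2 ?posrE ?invr_gt0//.
  exact: truncnS_gt.
have [q [q_ge0 q_le1] [tau_q Dq]] := ex m.
apply: le_trans (ltW (lt_trans Dq me)); apply: c_min.
rewrite in_itv/=; apply/andP; split; last by rewrite ler_piMr.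
by rewrite -lee_fin -tauE.
Qed.

End hitting_time.

(** * The successive reflections along one path *)

Section reflected_paths.
Context (R : realType) (T : Type) (eta nu rho : R) (BX BY : R -> T -> R).

Local Notation tau := (tau_ eta nu rho BX BY).
Local Notation Bt := (Btilde eta nu rho BX BY).
Local Notation Yk := (Y_ eta nu rho BX BY).
Local Notation a := (alpha eta nu).
Local Notation sig := (Num.sqrt (1 - rho ^+ 2)).

Lemma tauS k : tau k.+1 = next_hit BX (Yk k) (a k.+1) (tau k).
Proof. by []. Qed.

Lemma BtildeS k : Bt k.+1 = reflection (Bt k) (tau k.+1).
Proof. by []. Qed.

Lemma tau_nondecreasing k n w : (k <= n)%N -> (tau k w <= tau n w)%E.
Proof.
elim: n => [|n IHn]; first by rewrite leqn0 => /eqP ->.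
rewrite leq_eqVlt => /predU1P[->//|]; rewrite ltnS => /IHn /le_trans; apply.
by rewrite tauS; exact: next_hit_ge.
Qed.

Lemma tau_ge0 k w : (0 <= tau k w)%E.
Proof. exact: (tau_nondecreasing w (leq0n k)). Qed.

Section path.
Variable w : T.
Hypotheses (cX : continuous_path_from0 BX w) (cY : continuous_path_from0 BY w).

Lemma mix_path (B : R -> T -> R) : continuous_path_from0 B w ->
  continuous_path_from0 (mix rho B BY) w.
Proof.
move=> [B0 cB]; have [Y0 cBY] := cY; split; first by rewrite /mix B0 Y0 !mulr0 addr0.
move=> x; apply: cvgD; apply: cvgM; try exact: cvg_cst; [exact: cB|exact: cBY].
Qed.

Lemma Btilde_path k : continuous_path_from0 (Bt k) w.
Proof.
elim: k => [|k IHk]; last by rewrite BtildeS; apply: reflection_path => //; exact: tau_ge0.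
have [X0 cBX] := cX; split; first by rewrite /Btilde/= X0 oppr0.
by move=> x; apply: cvgN; exact: cBX.
Qed.

Lemma difference_path k : {within `[0, +oo[, continuous (fun t => BX t w - Yk k t w)}.
Proof.
have [_ cBX] := cX; have [_ cYk] := mix_path (Btilde_path k).
by move=> x; apply: cvgB; [exact: cBX|exact: cYk].
Qed.

Lemma tau_fine k t : (tau k w <= t%:E)%E -> tau k w = (fine (tau k w))%:E.
Proof.
by move=> le_t; rewrite fineK// ge0_fin_numE ?tau_ge0// (le_lt_trans le_t)// ltry.
Qed.

Lemma hit k t : (tau k.+1 w <= t%:E)%E ->
  BX (fine (tau k.+1 w)) w - Yk k (fine (tau k.+1 w)) w = a k.+1.
Proof.
move=> le_t.
have := next_hit_attained (a := a k.+1) (tau_ge0 k w) (@difference_path k).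
by rewrite -tauS => /(_ (le_lt_trans le_t (ltry _)))[].
Qed.

(** Time s itself is included, since a reflection fixes the point where it takes place; this is why
    the formulas hold on closed time intervals. *)
Lemma reflection_before (B : R -> T -> R) (s : T -> \bar R) t :
  (t%:E <= s w)%E -> reflection B s t w = B t w.
Proof.
move=> ts; rewrite reflectionE /min_time; case: ifP => [st|_]; last by ring.
have -> : s w = t%:E by apply/eqP; rewrite eq_le st ts.
by rewrite /=; ring.
Qed.

Lemma Btilde_before k n t : (k <= n)%N -> (t%:E <= tau k.+1 w)%E ->
  Bt n t w = Bt k t w.
Proof.
move=> + tk; elim: n => [|n IHn]; first by rewrite leqn0 => /eqP ->.
rewrite leq_eqVlt => /predU1P[<-//|]; rewrite ltnS => kn.
rewrite BtildeS reflection_before ?IHn//.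
exact: le_trans tk (tau_nondecreasing w _).
Qed.

(** The initial process is - B^X and each reflection adds a sign. Increments since the new hitting
    time are differences of increments since the previous one. *)
Lemma Btilde_after k t : (tau k w <= t%:E)%E ->
  Bt k t w - Bt k (fine (tau k w)) w =
  - (-1) ^+ k * (BX t w - BX (fine (tau k w)) w).
Proof.
elim: k t => [|k IHk] t le_t; first by rewrite /Btilde/= expr0; ring.
have rE := tau_fine le_t; set r := fine (tau k.+1 w) in rE *.
have kr : (tau k w <= r%:E)%E by rewrite -rE; exact: tau_nondecreasing.
have kt : (tau k w <= t%:E)%E by rewrite (le_trans _ le_t)// tau_nondecreasing.
have E1 := IHk t kt; have E2 := IHk r kr.
have Er : reflection (Bt k) (tau k.+1) r w = Bt k r w.
  by apply: reflection_before; rewrite rE.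
rewrite BtildeS Er reflectionE /min_time le_t -/r exprS.
have -> : 2 * Bt k r w - Bt k t w - Bt k r w =
  (Bt k r w - Bt k (fine (tau k w)) w) - (Bt k t w - Bt k (fine (tau k w)) w) by ring.
by rewrite E1 E2; ring.
Qed.

(** The hit at tau_k is one of Y^(k - 1), with which Y^k still agrees at that time. The hypothesis
    expresses that tau_k is finite. *)
Lemma difference_at_tau k t : (tau k w <= t%:E)%E ->
  BX (fine (tau k w)) w - Yk k (fine (tau k w)) w = a k.
Proof.
case: k => [|k] le_t.
  have [X0 _] := cX; have [Y0 _] := cY.
  by rewrite /Y_ /mix /Btilde/= X0 Y0; rewrite /alpha/=; ring.
rewrite -(hit le_t) /Y_ /mix BtildeS reflection_before//.
by rewrite -(tau_fine le_t).
Qed.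

Lemma difference_after k t : (tau k w <= t%:E)%E ->
  BX t w - Yk k t w = (1 + (-1) ^+ k * rho) * (BX t w - BX (fine (tau k w)) w)
    - sig * (BY t w - BY (fine (tau k w)) w) + a k.
Proof.
move=> le_t; rewrite -(difference_at_tau le_t) /Y_ /mix.
have E : Bt k t w = Bt k (fine (tau k w)) w -
    (-1) ^+ k * (BX t w - BX (fine (tau k w)) w).
  by rewrite -mulNr -(Btilde_after le_t); ring.
by rewrite E; ring.
Qed.

Lemma difference_between k n t : (k <= n)%N -> (tau k w <= t%:E)%E ->
  (t%:E <= tau k.+1 w)%E ->
  BX t w - Yk n t w = (1 + (-1) ^+ k * rho) * (BX t w - BX (fine (tau k w)) w)
    - sig * (BY t w - BY (fine (tau k w)) w) + a k.
Proof.
move=> kn kt tk; rewrite -(difference_after kt) /Y_ /mix.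
by rewrite (Btilde_before kn tk).
Qed.

(** Y^n is not reflected at tau_(n + 1): the sign remains that of n, while the reference point moves
    to tau_(n + 1), where the level alpha_(n + 1) is hit. *)
Lemma difference_last n t : (tau n.+1 w <= t%:E)%E ->
  BX t w - Yk n t w = (1 + (-1) ^+ n * rho) * (BX t w - BX (fine (tau n.+1 w)) w)
    - sig * (BY t w - BY (fine (tau n.+1 w)) w) + a n.+1.
Proof.
move=> le_t; rewrite -(hit le_t).
have rE := tau_fine le_t; set r := fine (tau n.+1 w) in rE *.
have nr : (tau n w <= r%:E)%E by rewrite -rE; exact: tau_nondecreasing.
have nt : (tau n w <= t%:E)%E by rewrite (le_trans _ le_t)// tau_nondecreasing.
by rewrite (difference_after nr) (difference_after nt); ring.
Qed.

Section finitely_many_reflections.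
Hypotheses (nu_lt_eta : nu < eta) (rho_ge0 : 0 <= rho) (rho_le1 : rho <= 1).

(** The indices start at 1 because alpha_0 = 0 need not be [nu]. *)
Lemma alpha_jump k : `|a k.+2 - a k.+1| = eta - nu.
Proof.
rewrite /alpha/=; case: (odd k) => /=.
  by rewrite gtr0_norm ?subr_gt0.
by rewrite distrC gtr0_norm ?subr_gt0.
Qed.

(* Between two consecutive hitting times the difference X - Y moves by at
   least eta - nu, which the uniform continuity of the paths forbids when the
   hitting times accumulate *)
Lemma tau_unbounded t : exists n, (t%:E < tau n w)%E.
Proof.
apply/not_existsP => bnd.
have le_t n : (tau n w <= t%:E)%E by rewrite leNgt; apply/negP; exact: bnd.
pose r n := fine (tau n w).
have rE n : tau n w = (r n)%:E := tau_fine (le_t n).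
have r0 n : 0 <= r n by rewrite -lee_fin -rE tau_ge0.
have r_nd : nondecreasing_seq r.
  by move=> m n mn; rewrite -lee_fin -!rE; exact: tau_nondecreasing.
have r_bnd : has_ubound (range r).
  by exists t => _ [n _ <-]; rewrite -lee_fin -rE.
have r_cvg := nondecreasing_cvgn r_nd r_bnd.
set l := sup _ in r_cvg.
have l0 : 0 <= l by rewrite (le_trans (r0 0%N))//; apply: ub_le_sup => //; exists 0%N.
have rS_cvg : r n.+1 @[n --> \oo] --> l by rewrite (cvg_shiftS r).
have inc0 B : continuous_path_from0 B w ->
    B (r n.+1) w - B (r n) w @[n --> \oo] --> (0 : R).
  move=> [_ cB]; rewrite -(subrr (B l w)).
  have c1 := half_line_cvg cB l0 (fun n => r0 n.+1) rS_cvg.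
  have c2 := half_line_cvg cB l0 r0 r_cvg.
  exact: cvgB c1 c2.
have step n : eta - nu <=
    2 * `|BX (r n.+2) w - BX (r n.+1) w| + `|BY (r n.+2) w - BY (r n.+1) w|.
  have nr : (tau n.+1 w <= (r n.+2)%:E)%E by rewrite -rE; exact: tau_nondecreasing.
  rewrite -(alpha_jump n) -(hit (le_t n.+2)) -/(r n.+2) (difference_after nr) -/(r n.+1).
  rewrite addrK; apply: (le_trans (ler_normB _ _)); rewrite !normrM.
  have s1 : `|sig| <= 1.
    by rewrite ger0_norm ?sqrtr_ge0// -[leRHS]sqrtr1 ler_wsqrtr// lerBlDr lerDl sqr_ge0.
  have x1 : `|1 + (-1) ^+ n.+1 * rho| <= 2.
    rewrite (le_trans (ler_normD _ _))// normr1 normrM normrX normrN1 expr1n mul1r.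
    by rewrite (ger0_norm rho_ge0) -[leRHS]/(1 + 1) lerD2l.
  by apply: lerD; [rewrite ler_wpM2r|rewrite ler_piMl].
(* With both increments below this, 2 |dX| + |dY| < 3 (eta - nu) / 4, against [step]. *)
have e0 : 0 < (eta - nu) / 4 by rewrite divr_gt0// subr_gt0.
have /cvgrPdist_lt/(_ _ e0) nX := inc0 BX cX.
have /cvgrPdist_lt/(_ _ e0) nY := inc0 BY cY.
suff : \forall n \near \oo, False by case=> N _ /(_ N); apply; rewrite /=.
near=> n.
have n1 : (0 < n)%N by near: n; exact: nbhs_infty_gt.
have : `|0 - (BX (r n.+1) w - BX (r n) w)| < (eta - nu) / 4 by near: n.
have : `|0 - (BY (r n.+1) w - BY (r n) w)| < (eta - nu) / 4 by near: n.
have := step n.-1; rewrite (prednK n1) !sub0r !normrN => h hY hX.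
by lra.
Unshelve. all: by end_near. Qed.

(** K is the last index with tau_K <= t. Index 0 satisfies the first clause, as tau_0 = 0, but the
    sum starts at 1, so it equals K and not K + 1. From K on, further reflections occur after t and
    leave Y_t unchanged. *)
Lemma nb_reflectionsP t : 0 <= t -> exists K, [/\
  forall n, (tau n w <= t%:E)%E = (n <= K)%N,
  nb_reflections eta nu rho BX BY t w = K%:R%:E &
  forall n, (K <= n)%N -> Yk n t w = Ylim eta nu rho BX BY t w].
Proof.
move=> t0; have exn : exists n, ~~ (tau n w <= t%:E)%E.
  by have [n tn] := tau_unbounded t; exists n; rewrite -ltNge.
have := ex_minnP exn => -[[|K] nK minK].
  by move: nK; rewrite /tau_/= lee_fin t0.
have leK n : (tau n w <= t%:E)%E = (n <= K)%N.
  apply/idP/idP => [nt|nK'].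
    rewrite leqNgt; apply/negP => Kn; move/negP: nK; apply.
    by apply: le_trans nt; exact: tau_nondecreasing.
  by apply/negPn/negP => /minK; rewrite ltnNge nK'.
have NE : nb_reflections eta nu rho BX BY t w = K%:R%:E.
  rewrite /nb_reflections; apply: lim_near_cst => //.
  exists K.+1 => // n /= Kn.
  under eq_bigr do rewrite leK.
  have sumE m : (\sum_(1 <= i < m.+1) ((i <= K)%N)%:R%:E)%E = (minn m K)%:R%:E :> \bar R.
    elim: m => [|m IHm]; first by rewrite big_geq// min0n.
    rewrite big_nat_recr//= IHm -EFinD -natrD; congr (_%:R%:E).
    by case: (leqP m.+1 K) => mK; lia.
  by case: n Kn => // n Kn; rewrite sumE; congr (_%:R%:E); apply/minn_idPr.
exists K; split => // n Kn; rewrite /Ylim NE /= natrK.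
rewrite /Y_ /mix; congr (_ * _ + _); apply: Btilde_before => //.
by rewrite ltW// ltNge.
Qed.

(** Continuity at r is inherited from Y^M, where M counts the reflections up to r + 1; hence the cap
    of 1 on the radius. *)
Lemma Ylim_path : continuous_path_from0 (Ylim eta nu rho BX BY) w.
Proof.
split.
  have [K [_ _ YE]] := nb_reflectionsP (lexx 0).
  by rewrite -(YE K)//; have [] := mix_path (Btilde_path K).
apply/within_half_lineP => r e r0 e0.
have r1 : 0 <= r + 1 by rewrite addr_ge0.
have [M [leM _ _]] := nb_reflectionsP r1.
have YM x : 0 <= x -> x <= r + 1 -> Ylim eta nu rho BX BY x w = Yk M x w.
  move=> x0 xr; have [K [leK _ YE]] := nb_reflectionsP x0.
  rewrite -(YE M)// -leM; apply: (@le_trans _ _ x%:E); last by rewrite lee_fin.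
  by rewrite leK.
have [_ /within_half_lineP cM] := mix_path (Btilde_path M).
have [del del0 delP] := cM r e r0 e0.
exists (Num.min del 1); first by rewrite lt_min del0/=.
move=> x x0; rewrite lt_min => /andP[xdel x1].
rewrite !YM ?lerDl//; first exact: delP.
by rewrite -lerBlDl ltW// (le_lt_trans _ x1)// ler_norm.
Qed.

End finitely_many_reflections.
End path.
End reflected_paths.

(** * Limits of Brownian motions *)

Section brownian_limit.
Context d (T : measurableType d) (R : realType) (P : probability T R).
Context (F : R -> set_system T) (Ffilt : filtration F).
Hypothesis Fusual : usual_conditions P F.

(** Eventual equality, stronger than convergence, makes the indicators of the events Z_n in D
    converge for every Borel set D, without passing through continuous test functions. *)
Lemma brownian_motion_ae_cvg (Y_ : nat -> R -> T -> R) (Y : R -> T -> R) :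
  (forall n, brownian_motion P F (Y_ n)) ->
  (\forall w \ae P, continuous_path_from0 Y w) ->
  (forall t, 0 <= t -> \forall w \ae P, \forall n \near \oo, Y_ n t w = Y t w) ->
  brownian_motion P F Y.
Proof.
move=> Ybm Ypath Ycvg.
have aY : adapted F Y.
  move=> t t0; have sF := filtration_algebra Ffilt t0.
  have Fnull N : P.-negligible N -> F t N by exact: filtration_null.
  apply: (Gmeas_ae_cvg sF Fnull (f_ := fun n => Y_ n t)).
    by move=> n; have [aYn _ _] := Ybm n; exact: aYn.
  by apply: filterS (Ycvg t t0) => w Yw; exact: cvg_near_cst.
split => // s t s0 st; have t0 : 0 <= t by rewrite ltW// (le_lt_trans s0).
pose Z w := Y t w - Y s w; pose Z_ n w := Y_ n t w - Y_ n s w.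
have mZ : measurable_fun setT Z.
  by apply: measurable_funB; exact: (adapted_measurable Ffilt).
have mZn n : measurable_fun setT (Z_ n).
  have [aYn _ _] := Ybm n.
  by apply: measurable_funB; exact: (adapted_measurable Ffilt).
have mpre (V : T -> R) D : measurable_fun setT V -> measurable D ->
    measurable (V @^-1` D).
  by move=> mV mD; rewrite -[X in measurable X]setTI; exact: mV.
have law A D : F s A -> measurable D ->
    P (A `&` Z @^-1` D) = (P A * normal_prob 0 (Num.sqrt (t - s)) D)%E.
  move=> FA mD; have mA := filtration_measurable Ffilt s0 FA.
  have lawn n : P (A `&` Z_ n @^-1` D) = (P A * normal_prob 0 (Num.sqrt (t - s)) D)%E.
    have [_ _ /(_ s t s0 st)[ind nl]] := Ybm n.
    rewrite (ind A (Z_ n @^-1` D))//; last by exists D => //; rewrite setTI.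
    by rewrite -nl.
  have mI (V : T -> R) : measurable_fun setT V -> measurable (A `&` V @^-1` D).
    by move=> mV; apply: measurableI => //; exact: mpre.
  have c1 : Ex P (\1_(A `&` Z_ n @^-1` D)) @[n --> \oo] --> Ex P (\1_(A `&` Z @^-1` D)).
    apply: (Ex_cvg_bounded (K := 1)).
    - by move=> n; apply: measurable_indic; exact: mI.
    - by apply: measurable_indic; exact: mI.
    - apply: filterS2 (Ycvg t t0) (Ycvg s s0) => w Yt Ys.
      apply: cvg_near_cst; near=> n.
      rewrite !indicE !in_setI; congr (_ && _)%:R.
      have E : Z_ n w = Z w.
        by rewrite /Z_ /Z; congr (_ - _); near: n.
      by apply/idP/idP; rewrite !inE /= E.
    - by move=> n w; rewrite indicE; case: (_ \in _); rewrite ?normr1 ?normr0.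
  have c2 : Ex P (\1_(A `&` Z_ n @^-1` D)) @[n --> \oo] -->
      fine (P A * normal_prob 0 (Num.sqrt (t - s)) D)%E.
    by apply: cvg_near_cst; apply: nearW => n; rewrite Ex_indic ?lawn//; exact: mI.
  have fin1 := fin_num_measure P _ (mI _ mZ).
  have fin2 : (P A * normal_prob 0 (Num.sqrt (t - s)) D)%E \is a fin_num.
    by apply: fin_numM; exact: fin_num_measure.
  rewrite -(fineK fin1) -(fineK fin2) -Ex_indic; last exact: mI.
  by congr (_%:E); exact: (cvg_unique (@Rhausdorff R) c1 c2).
have lawZ D : measurable D -> P (Z @^-1` D) = normal_prob 0 (Num.sqrt (t - s)) D.
  move=> mD; have := law setT D (G_setT (filtration_algebra Ffilt s0)) mD.
  by rewrite setTI probability_setT mul1e.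
split; last exact: lawZ.
by move=> A _ FA [D mD <-]; rewrite setTI law// lawZ.
Unshelve. all: by end_near. Qed.

End brownian_limit.

(** * Induction over the reflections, and conclusion *)

Section reflected_brownian.
Context d (T : measurableType d) (R : realType) (P : probability T R).
Context (F : R -> set_system T) (Ffilt : filtration F).
Hypothesis Fusual : usual_conditions P F.
Context (eta nu rho : R) (BX BY : R -> T -> R).
Hypotheses (BX_bm : brownian_motion P F BX) (BY_bm : brownian_motion P F BY).
Hypothesis BXY_indep : independent_processes P BX BY.

Lemma gaussian_pairN (U V : R -> T -> R) : gaussian_pair P F U V ->
  gaussian_pair P F (fun t w => - U t w) V.
Proof.
move=> [aU aV E]; split => //.
  move=> t t0; have sF := filtration_algebra Ffilt t0.
  have := GmeasZ sF (-1) (aU t t0).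
  by under eq_fun do rewrite mulN1r.
move=> s t A a b c s0 st FA.
rewrite -(sqrrN a) -(E s t A (- a) b c s0 st FA).
by apply: Ex_eq => w; congr (_ * cos _); ring.
Qed.

Lemma ae_paths :
  \forall w \ae P, continuous_path_from0 BX w /\ continuous_path_from0 BY w.
Proof.
by have [_ pX _] := BX_bm; have [_ pY _] := BY_bm; apply: filterS2 pX pY.
Qed.

(** The two claims need a joint induction: tau_(k + 1) is a stopping time because Y^k is adapted,
    and reflecting at it needs a stopping time. *)
Lemma reflected_gaussian_pair k :
  gaussian_pair P F (Btilde eta nu rho BX BY k) BY /\
  stopping_time F (tau_ eta nu rho BX BY k).
Proof.
elim: k => [|k [gk sk]].
  split; first by apply: gaussian_pairN; exact: gaussian_pair_indep.
  split => [w|t t0]; first exact: lexx.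
  rewrite (_ : [set w | _] = setT); first exact: (G_setT (filtration_algebra Ffilt t0)).
  by apply/seteqP; split => // w _; rewrite /= lee_fin.
have [aX _ _] := BX_bm; have [aB aY _] := gk.
have st : stopping_time F (tau_ eta nu rho BX BY k.+1).
  rewrite tauS; apply: (next_hit_stopping Ffilt Fusual) => //.
    move=> t t0; have sF := filtration_algebra Ffilt t0.
    exact: (GmeasD sF (GmeasZ sF rho (aB t t0)) (GmeasZ sF _ (aY t t0))).
  by apply: filterS ae_paths => w [cX cY]; exact: difference_path.
split => //; rewrite BtildeS; apply: gaussian_pair_reflection => //.
by apply: filterS ae_paths => w [cX cY]; exact: Btilde_path.
Qed.

End reflected_brownian.

Theorem proposition3 (R : realType) (d : measure_display)
    (T : measurableType d) (P : probability T R) (F : R -> set_system T)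
    (eta nu rho : R) (BX BY : R -> T -> R)
    (Ffilt : filtration F) (Fusual : usual_conditions P F)
    (eta_gt0 : 0 < eta) (nu_lt_eta : nu < eta)
    (rho_ge0 : 0 <= rho) (rho_le1 : rho <= 1)
    (BX_bm : brownian_motion P F BX) (BY_bm : brownian_motion P F BY)
    (BXY_indep : independent_processes P BX BY) :
  let X := BX in
  let a := alpha eta nu in
  let tau := tau_ eta nu rho BX BY in
  let Yk := Y_ eta nu rho BX BY in
  let N := nb_reflections eta nu rho BX BY in
  let Y := Ylim eta nu rho BX BY in
  [/\ (forall k, brownian_motion P F (Yk k)) /\
      (forall k, stopping_time F (tau k)),
      (forall w, continuous_path_from0 BX w -> continuous_path_from0 BY w ->
       forall (n : nat) (t : R), 0 < t ->
         (forall k : nat, (k <= n)%N ->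
            (tau k w <= t%:E)%E -> (t%:E <= tau k.+1 w)%E ->
            X t w - Yk n t w =
              (1 + (-1) ^+ k * rho) * (BX t w - BX (fine (tau k w)) w)
              - Num.sqrt (1 - rho ^+ 2) * (BY t w - BY (fine (tau k w)) w)
              + a k) /\
         ((tau n.+1 w <= t%:E)%E ->
            X t w - Yk n t w =
              (1 + (-1) ^+ n * rho) * (BX t w - BX (fine (tau n.+1 w)) w)
              - Num.sqrt (1 - rho ^+ 2) * (BY t w - BY (fine (tau n.+1 w)) w)
              + a n.+1)),
      (forall t, 0 < t -> \forall w \ae P, (N t w < +oo)%E)
    & brownian_motion P F Y].
Proof.
move=> X a tau Yk N Y.
have paths := ae_paths BX_bm BY_bm.
have pairs k := reflected_gaussian_pair Ffilt Fusual eta nu rho BX_bm BY_bm BXY_indep k.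
have Yk_bm k : brownian_motion P F (Yk k).
  apply: (gaussian_pair_brownian Ffilt BX_bm _ (pairs k).1).
  - exact: (gaussian_pair_indep Ffilt BX_bm BY_bm BXY_indep).
  - rewrite sqr_sqrtr ?subrKC// subr_ge0 -[leRHS](expr1n _ 2).
    by rewrite lerXn2r// nnegrE.
  - by apply: filterS paths => w [cX cY]; apply: mix_path => //; exact: Btilde_path.
split.
- by split => // k; exact: (pairs k).2.
- move=> w cX cY n t _; split=> [k|]; first exact: difference_between.
  exact: difference_last.
- move=> t t0; apply: filterS paths => w [cX cY].
  have [K [_ NE _]] := nb_reflectionsP cX cY nu_lt_eta rho_ge0 rho_le1 (ltW t0).
  by rewrite /N NE ltry.
- apply: (brownian_motion_ae_cvg Ffilt Fusual Yk_bm).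
    by apply: filterS paths => w [cX cY]; exact: Ylim_path.
  move=> t t0; apply: filterS paths => w [cX cY].
  have [K [_ _ YE]] := nb_reflectionsP cX cY nu_lt_eta rho_ge0 rho_le1 t0.
  by exists K => // n /= Kn; exact: YE.
Qed.
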